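(* Let $k$ be a field of characteristic $0$ and $V$ a finitely generated $\mathrm{FI}^m$-module. Then there is some $\mathbf a\in\mathbb{N}^m$ such that $S_{+\mathbf a}V$ is filtered. Furthermore, there are filtered $\mathrm{FI}^m$-modules $J^0,\dots,J^N$ and a complex $0\to V\to J^0\to\cdots\to J^N\to0$ which is exact in high enough degree, i.e. $0\to V_{\mathbf d}\to J^0_{\mathbf d}\to\cdots\to J^N_{\mathbf d}\to0$ is exact for all sufficiently large $\mathbf d$.
   Context: $\mathrm{FI}^m$-modules are functors from the product category $\mathrm{FI}^m$ (objects $\mathbf d\in\mathbb{N}^m$, morphisms tuples of injections) to $k$-vector spaces; $M(\mathbf c)=k[\mathrm{Hom}_{\mathrm{FI}^m}(\mathbf c,-)]$; $S_{+\mathbf a}(V)_{\mathbf d}=V_{\mathbf d+\mathbf a}$. A module is projective iff it is a direct sum of modules $\mathrm{Ind}^{\mathrm{FI}^m}(W)$, where for an $S_{\mathbf c}$-representation $W$, $\mathrm{Ind}^{\mathrm{FI}^m}(W)_{\mathbf c+\mathbf b}=\mathrm{Ind}^{S_{\mathbf c+\mathbf b}}_{S_{\mathbf c}\times S_{\mathbf b}}W\boxtimes k$. A finitely generated $\mathrm{FI}^m$-module $V$ is filtered if it admits a surjection $\Pi:\bigoplus_{i=1}^gM(\mathbf d_i)\twoheadrightarrow V$ such that, with $V^r=\Pi(\bigoplus_{i=1}^rM(\mathbf d_i))$, all successive quotients $V^r/V^{r-1}$ are projective $\mathrm{FI}^m$-modules. *)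

(* Defs.v *)
From HB Require Import structures.
From mathcomp Require Import all_boot all_order all_algebra.
Set Implicit Arguments. Unset Strict Implicit. Unset Printing Implicit Defensive.
Import GRing.Theory.

Definition injfun (a b : nat) := {f : {ffun 'I_a -> 'I_b} | injectiveb f}.

Lemma injfun_id_proof a : injectiveb [ffun x : 'I_a => x].
Proof. by apply/injectiveP => x y; rewrite !ffunE. Qed.
Definition injfun_id a : injfun a a := exist (fun f : {ffun _ -> _} => injectiveb f) _ (injfun_id_proof a).

Lemma injfun_comp_proof a b c (f : injfun a b) (g : injfun b c) :
  injectiveb [ffun x => val g (val f x)].
Proof.
have /injectiveP Hf := valP f; have /injectiveP Hg := valP g.
by apply/injectiveP => x y; rewrite !ffunE => /Hg /Hf.
Qed.
Definition injfun_comp a b c (f : injfun a b) (g : injfun b c) : injfun a c :=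
  exist (fun f : {ffun _ -> _} => injectiveb f) _ (injfun_comp_proof f g).

Definition shift_ffun a b n (f : {ffun 'I_a -> 'I_b}) : {ffun 'I_(a + n) -> 'I_(b + n)} :=
  [ffun x => match split x with inl u => lshift n (f u) | inr y => rshift b y end].

Lemma injfun_shift_proof a b n (f : injfun a b) : injectiveb (shift_ffun n (val f)).
Proof.
have /injectiveP Hf := valP f.
apply/injectiveP => x y; rewrite !ffunE => H.
apply: (can_inj (@splitK _ _)); move: H.
case: (split x) => u; case: (split y) => v /= /(congr1 val) /= E.
- by rewrite (Hf _ _ (val_inj E)).
- by have := ltn_ord (val f u); rewrite E ltnNge leq_addr.
- by have := ltn_ord (val f v); rewrite -E ltnNge leq_addr.
- by rewrite (val_inj (addnI E)).
Qed.
Definition injfun_shift a b n (f : injfun a b) : injfun (a + n) (b + n) :=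
  exist (fun f : {ffun _ -> _} => injectiveb f) _ (injfun_shift_proof n f).

Definition obj (m : nat) := 'I_m -> nat.
Definition hom m (c d : obj m) := {dffun forall i : 'I_m, injfun (c i) (d i)}.

Definition hom_id m (c : obj m) : hom c c := [ffun i => injfun_id (c i)].
Definition hom_comp m (c d e : obj m) (f : hom c d) (g : hom d e) : hom c e :=
  [ffun i => injfun_comp (f i) (g i)].

Definition obj_add m (d a : obj m) : obj m := fun i => (d i + a i)%N.
Definition hom_shift m (a c d : obj m) (f : hom c d) : hom (obj_add c a) (obj_add d a) :=
  [ffun i => injfun_shift (a i) (f i)].

Definition obj_le m (b d : obj m) := forall i, (b i <= d i)%N.

Lemma hom_shift_id m (a c : obj m) : hom_shift a (hom_id c) = hom_id (obj_add c a).
Proof.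
apply/ffunP => i; rewrite !ffunE; apply/val_inj/ffunP => x /=.
rewrite !ffunE -[x in RHS](splitK x); case: (split x) => j /=; last by [].
by rewrite ffunE.
Qed.

Lemma hom_shift_comp m (a c d e : obj m) (f : hom c d) (g : hom d e) :
  hom_shift a (hom_comp f g) = hom_comp (hom_shift a f) (hom_shift a g).
Proof.
apply/ffunP => i; rewrite !ffunE; apply/val_inj/ffunP => x /=.
rewrite !ffunE; case: (split x) => j /=.
- by rewrite ffunE (unsplitK (inl _)) /=.
- by rewrite (unsplitK (inr _)).
Qed.

Local Open Scope ring_scope.

Record FImMod (k : fieldType) (m : nat) := {
  fob :> obj m -> lmodType k;
  fact : forall c d : obj m, hom c d -> fob c -> fob d;
  fact_lin : forall c d (f : hom c d) (a : k) (x y : fob c),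
      fact f (a *: x + y) = a *: fact f x + fact f y;
  fact_id : forall c (x : fob c), fact (hom_id c) x = x;
  fact_comp : forall c d e (f : hom c d) (g : hom d e) (x : fob c),
      fact (hom_comp f g) x = fact g (fact f x) }.
Arguments fact {k m} f0 {c d} f x.

Section Mods.
Variables (k : fieldType) (m : nat).

Definition shift_mod (V : FImMod k m) (a : obj m) : FImMod k m.
Proof.
refine {| fob := fun d => V (obj_add d a);
          fact := fun c d f x => fact V (hom_shift a f) x |}.
- by move=> c d f r x y; rewrite fact_lin.
- by move=> c x; rewrite hom_shift_id fact_id.
- by move=> c d e f g x; rewrite hom_shift_comp fact_comp.
Defined.

Definition is_mor (V W : FImMod k m) (p : forall d, V d -> W d) :=
  (forall d (a : k) (x y : V d), p d (a *: x + y) = a *: p d x + p d y) /\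
  (forall c d (f : hom c d) (x : V c), p d (fact V f x) = fact W f (p c x)).

(* the submodule of V generated by the first r of the elements v_j in V_(c j),
   i.e. the image of  \bigoplus_(j < r) M(c j) -> V,  1_(c j) |-> v_j *)
Inductive gen (V : FImMod k m) (g : nat) (c : 'I_g -> obj m) (v : forall j, V (c j))
    (r : nat) : forall d, V d -> Prop :=
| gen_gen (j : 'I_g) d (f : hom (c j) d) : (j < r)%N -> gen v r (fact V f (v j))
| gen_0 d : gen v r (0 : V d)
| gen_add d (x y : V d) : gen v r x -> gen v r y -> gen v r (x + y)
| gen_scale d (a : k) (x : V d) : gen v r x -> gen v r (a *: x).

Definition finitely_generated (V : FImMod k m) :=
  exists g (c : 'I_g -> obj m) (v : forall j, V (c j)), forall d (x : V d), gen v g x.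

(* a family phi_d : V_d -> B_d representing a morphism S/T -> B, where T <= S
   are submodules of V: linear and natural on S, zero on T *)
Definition quot_hom (V : FImMod k m) (S T : forall d, V d -> Prop) (B : FImMod k m)
    (phi : forall d, V d -> B d) :=
  [/\ forall d (a : k) (x y : V d), S d x -> S d y ->
        phi d (a *: x + y) = a *: phi d x + phi d y,
      forall d (x : V d), T d x -> phi d x = 0 &
      forall c d (f : hom c d) (x : V c), S c x -> phi d (fact V f x) = fact B f (phi c x)].

Definition projective_subquotient (V : FImMod k m) (S T : forall d, V d -> Prop) :=
  forall (A B : FImMod k m) (p : forall d, A d -> B d),
    is_mor p -> (forall d (y : B d), exists x, p d x = y) ->
    forall phi, quot_hom S T phi ->
    exists psi, quot_hom S T psi /\ forall d (x : V d), S d x -> p d (psi d x) = phi d x.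

(* filtered: a surjection Pi : \bigoplus_(i<g) M(c i) ->> V with V^r/V^(r-1) projective *)
Definition filtered (V : FImMod k m) :=
  exists g (c : 'I_g -> obj m) (v : forall j, V (c j)),
    (forall d (x : V d), gen v g x) /\
    forall r, (r < g)%N -> projective_subquotient (gen v r.+1) (gen v r).

End Mods.

(* Main.v *)
(* Let [w] generate a cyclic module [V] in degree [c].  In the shift [S_(+b) V], the
   images of [w] under injections that meet the added block generate a submodule in
   degrees smaller than [c], and modulo it the shift is again generated by [w].  The
   space of relations among the [s w], [s] in [hom c c], modulo this submodule grows
   with [b] inside a finite-dimensional space, so it stabilizes.  Once it is stable,
   moving the complement of the image of an injection into the added block shows
   that every relation is a sum of relations supported on single images; the top
   quotient is then projective in characteristic 0, by averaging.  Induction on the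
   degree filters a shift of any finitely generated [V].  The cokernel of
   [V -> S_(+a) V] is generated in smaller degree than [V], and this map is injective
   in degrees [>= a] because filtered modules are torsion free: iterating it gives
   the complex. *)
From Stdlib Require List.
From HB Require Import structures.
From mathcomp Require Import all_boot all_order all_algebra ring_quotient generic_quotient.
From mathcomp Require Import boolp.
Require Import Defs.
Set Implicit Arguments. Unset Strict Implicit. Unset Printing Implicit Defensive.
Import GRing.Theory.
Local Open Scope ring_scope.

(** * Morphisms of FI^m *)

Section Homs.
Variable m : nat.
Implicit Types c d e a b : obj m.

Definition ap c d (f : hom c d) i (x : 'I_(c i)) : 'I_(d i) := val (f i) x.

Lemma ap_inj c d (f : hom c d) i : injective (ap f (i := i)).
Proof. exact/injectiveP/(valP (f i)). Qed.

Lemma homP c d (f g : hom c d) : (forall i x, ap f (i := i) x = ap g x) -> f = g.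
Proof. by move=> fg; apply/ffunP => i; apply/val_inj/ffunP => x; exact: fg. Qed.

Lemma mkhom_proof c d (F : forall i, 'I_(c i) -> 'I_(d i)) (Finj : forall i, injective (@F i)) i :
  injectiveb [ffun x => F i x].
Proof. by apply/injectiveP => x y; rewrite !ffunE => /Finj. Qed.

Definition mkhom c d (F : forall i, 'I_(c i) -> 'I_(d i)) (Finj : forall i, injective (@F i)) :
  hom c d := [ffun i => exist (fun f : {ffun _ -> _} => injectiveb f) _ (mkhom_proof Finj i)].

Lemma ap_mkhom c d (F : forall i, 'I_(c i) -> 'I_(d i)) (Finj : forall i, injective (@F i)) i x :
  ap (mkhom Finj) x = F i x.
Proof. by rewrite /ap ffunE /= ffunE. Qed.

Lemma ap_id c i (x : 'I_(c i)) : ap (hom_id c) x = x.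
Proof. by rewrite /ap !ffunE. Qed.

Lemma ap_comp c d e (f : hom c d) (g : hom d e) i (x : 'I_(c i)) :
  ap (hom_comp f g) x = ap g (ap f x).
Proof. by rewrite /ap !ffunE. Qed.

Definition inl_ c a i (x : 'I_(c i)) : 'I_(obj_add c a i) := lshift (a i) x.
Definition inr_ c a i (x : 'I_(a i)) : 'I_(obj_add c a i) := rshift (c i) x.
Arguments inl_ {c} a {i} x.
Arguments inr_ c {a i} x.

Variant split_spec c a i : 'I_(obj_add c a i) -> Prop :=
| SplitL (x : 'I_(c i)) : split_spec (inl_ a x)
| SplitR (x : 'I_(a i)) : split_spec (inr_ c x).

Lemma splitV c a i (x : 'I_(obj_add c a i)) : split_spec x.
Proof.
rewrite -[x](@splitK (c i) (a i)); case: (split _) => y /=.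
- exact: (@SplitL c a).
- exact: (@SplitR c a).
Qed.

Lemma inl_inj c a i : injective (@inl_ c a i).
Proof. exact: lshift_inj. Qed.
Lemma inr_inj c a i : injective (@inr_ c a i).
Proof. exact: rshift_inj. Qed.
Lemma inlrE c a i (x : 'I_(c i)) (y : 'I_(a i)) : inl_ a x <> inr_ c y.
Proof. by move=> /eqP; rewrite /inl_ /inr_ eq_lrshift. Qed.

Lemma ap_shiftl c d a (f : hom c d) i (x : 'I_(c i)) :
  ap (hom_shift a f) (inl_ a x) = inl_ a (ap f x).
Proof. by rewrite /ap !ffunE (unsplitK (inl _)). Qed.

Lemma ap_shiftr c d a (f : hom c d) i (x : 'I_(a i)) :
  ap (hom_shift a f) (inr_ c x) = inr_ d x.
Proof. by rewrite /ap !ffunE (unsplitK (inr _)). Qed.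

Definition inc c a : hom c (obj_add c a) := mkhom (fun i => @inl_inj c a i).

Lemma ap_inc c a i (x : 'I_(c i)) : ap (inc c a) x = inl_ a x.
Proof. exact: ap_mkhom. Qed.

Lemma hom_comp_id c d (f : hom c d) : hom_comp f (hom_id d) = f.
Proof. by apply: homP => i x; rewrite ap_comp ap_id. Qed.

Lemma hom_id_comp c d (f : hom c d) : hom_comp (hom_id c) f = f.
Proof. by apply: homP => i x; rewrite ap_comp ap_id. Qed.

Lemma hom_compA c d e a (f : hom c d) (g : hom d e) (h : hom e a) :
  hom_comp f (hom_comp g h) = hom_comp (hom_comp f g) h.
Proof. by apply: homP => i x; rewrite !ap_comp. Qed.

Lemma hom_comp_inj c d e (g : hom d e) : injective (fun f : hom c d => hom_comp f g).
Proof.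
move=> f f' ff'; apply: homP => i x; apply: (@ap_inj _ _ g).
by rewrite -!ap_comp ff'.
Qed.

(** Right composition with [s] is injective on the finite set [hom c c], hence bijective; so
    [hom c c] is a group, a product of symmetric groups. *)
Lemma hom_linv c (s : hom c c) : exists t : hom c c, hom_comp t s = hom_id c.
Proof.
by have [t _ ts] := injF_bij (hom_comp_inj (c := c) (g := s)); exists (t (hom_id c)); exact: ts.
Qed.

Lemma hom_precomp_inj c d (s : hom c c) : injective (fun g : hom c d => hom_comp s g).
Proof.
have [t ts] := hom_linv s => f g /(congr1 (hom_comp t)).
by rewrite !hom_compA ts !hom_id_comp.
Qed.

Lemma inc_natural c d a (f : hom c d) : hom_comp f (inc d a) = hom_comp (inc c a) (hom_shift a f).
Proof. by apply: homP => i x; rewrite !ap_comp !ap_inc ap_shiftl. Qed.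


Lemma hom_factor c d e (g : hom c d) (f : hom e d) :
  (forall i x, exists y, ap g (i := i) x = ap f y) -> exists s : hom c e, g = hom_comp s f.
Proof.
move=> gf; pose F i := projT1 (choice (gf i)).
have FE i x : ap g x = ap f (F i x) := projT2 (choice (gf i)) x.
have Finj i : injective (@F i).
  by move=> x y Fxy; apply: (@ap_inj _ _ g); rewrite !FE Fxy.
by exists (mkhom Finj); apply: homP => i x; rewrite ap_comp ap_mkhom.
Qed.

(** * Injections into a shifted object *)

Definition outside c d b (g : hom c (obj_add d b)) := exists i x z, ap g (i := i) x = inr_ d z.

Lemma outside_or c d b (g : hom c (obj_add d b)) :
  outside g \/ exists f : hom c d, g = hom_comp f (inc d b).
Proof.
case: (EM (outside g)) => [|gin]; [by left | right].
apply: hom_factor => i x; case E: _ / (splitV (ap g x)) => [y|z].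
  by exists y; rewrite ap_inc.
by case: gin; exists i, x, z.
Qed.

(** Such an [h] hits all of the unshifted part, so it does not come from a smaller [e]. These are
    the minimal generators of the shift by [b] of M(c). *)
Definition onto c e b (h : hom c (obj_add e b)) := forall i y, exists x, ap h (i := i) x = inl_ b y.

(** Let [e] count the points of [d] that [g] hits, and let [f] enumerate them. *)
Lemma hom_shift_factor c d b (g : hom c (obj_add d b)) :
  exists e (h : hom c (obj_add e b)) (f : hom e d), onto h /\ hom_comp h (hom_shift b f) = g.
Proof.
pose P i := [pred y : 'I_(d i) | [exists x, ap g x == inl_ b y]].
have Finj i : injective (fun x : 'I_#|P i| => enum_val x) by exact: enum_val_inj.
pose f : hom (fun i => #|P i|) d := mkhom Finj.
have [h gh] : exists h : hom c (obj_add (fun i => #|P i|) b), g = hom_comp h (hom_shift b f).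
  apply: hom_factor => i x; case E: _ / (splitV (ap g x)) => [y|z].
    have Py : y \in P i by apply/existsP; exists x; rewrite -E.
    by exists (inl_ b (enum_rank_in Py y)); rewrite ap_shiftl ap_mkhom enum_rankK_in.
  by exists (inr_ _ z); rewrite ap_shiftr.
exists (fun i => #|P i|), h, f; split=> // i y.
have /existsP[x /eqP gx] := enum_valP y; exists x.
by apply: (@ap_inj _ _ (hom_shift b f)); rewrite -ap_comp -gh gx ap_shiftl ap_mkhom.
Qed.

Definition deg c := \sum_i c i.

Lemma onto_section c e b (h : hom c (obj_add e b)) : onto h ->
  forall i, exists s : 'I_(e i) -> 'I_(c i), injective s /\ forall y, ap h (s y) = inl_ b y.
Proof.
move=> hon i; have [s hs] := choice (hon i); exists s; split=> // y y' ss.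
by apply: (@inl_inj _ b); rewrite -!hs ss.
Qed.

Lemma onto_le c e b (h : hom c (obj_add e b)) : onto h -> obj_le e c.
Proof.
by move=> hon i; have [s [/leq_card]] := onto_section hon i; rewrite !card_ord.
Qed.

(** A section of [h] over [e] embeds [e i] in [c i] and misses the point that [h] sends to the added
    block, so one coordinate drops. *)
Lemma onto_outside_deg c e b (h : hom c (obj_add e b)) : onto h -> outside h -> (deg e < deg c)%N.
Proof.
move=> hon [i [x [z hx]]]; rewrite /deg (bigD1 i) //= [ltnRHS](bigD1 i) //= -addSn.
apply: leq_add; last by apply: leq_sum => j _; apply: (onto_le hon).
have [s [sinj hs]] := onto_section hon i.
rewrite -[e i]card_ord -(card_codom sinj) -[ltnRHS]card_ord; apply: proper_card.
apply/properP; split; first exact/subsetP.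
exists x => //; apply/negP => /codomP[y xy].
by move: (hs y); rewrite -xy hx => /esym/inlrE.
Qed.

Lemma In_mem (T : eqType) (s : seq T) x : x \in s -> List.In x s.
Proof. by elim: s => //= y s IH; rewrite inE => /orP[/eqP->|/IH]; [left|right]. Qed.

Lemma In_filter (T : Type) (p : pred T) (s : seq T) x :
  List.In x (filter p s) <-> List.In x s /\ p x.
Proof.
elim: s => [|y s IH] /=; first by split=> [|[]].
case py: (p y) => /=; rewrite IH; split.
- by move=> [<-|[sx px]]; split=> //; [left|right].
- by move=> [[->|sx] px]; [left|right].
- by move=> [sx px]; split=> //; right.
- by move=> [[yx|sx] px] //; move: px; rewrite -yx py.
Qed.

Lemma enum_shift_homs c b : exists s : seq {e : obj m & hom c (obj_add e b)},
  forall e (h : hom c (obj_add e b)), obj_le e c -> List.In (existT _ e h) s.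
Proof.
pose n := (\max_i c i).+1.
pose toobj (e : {ffun 'I_m -> 'I_n}) : obj m := fun i => e i.
pose T := {e : {ffun 'I_m -> 'I_n} & hom c (obj_add (toobj e) b)}.
pose F (x : T) : {e : obj m & hom c (obj_add e b)} := existT _ (toobj (projT1 x)) (projT2 x).
exists [seq F x | x : T] => e h ec.
have [e' ee] : exists e' : {ffun 'I_m -> 'I_n}, toobj e' = e.
  exists [ffun i => inord (e i)].
  by apply: funext => i; rewrite /toobj ffunE inordK // ltnS (leq_trans (ec i)) // leq_bigmax.
case: e / ee h ec => h _.
by apply: (List.in_map F _ (existT _ e' h)); apply: In_mem; rewrite mem_enum.
Qed.

Section Theta.
Variables (c d a b : obj m) (f0 : hom c d) (u : hom (obj_add d b) a).

(** Inverse of [f0] on its image; everything else, the old block included, is moved by [u] into the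
    new block [a]. This isolates the part of a relation supported on the image of [f0]. *)
Definition theta_fun i (x : 'I_(obj_add d b i)) : 'I_(obj_add c a i) :=
  if [pick y | inl_ b (ap f0 y) == x] is Some y then inl_ a y else inr_ c (ap u x).

Lemma theta_inj i : injective (@theta_fun i).
Proof.
move=> x x'; rewrite /theta_fun.
case: pickP => [y /eqP<-|_]; case: pickP => [y' /eqP<-|_].
- by move=> /inl_inj->.
- by move=> /inlrE.
- by move=> /esym/inlrE.
- by move=> /inr_inj/ap_inj.
Qed.

Definition theta := mkhom theta_inj.

Lemma ap_theta_in i y : ap theta (inl_ b (ap f0 (i := i) y)) = inl_ a y.
Proof.
rewrite ap_mkhom /theta_fun; case: pickP => [y' /eqP/inl_inj/ap_inj->//|/(_ y)].
by rewrite eqxx.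
Qed.

Lemma ap_theta_out i x : (forall y, x <> inl_ b (ap f0 (i := i) y)) ->
  ap theta x = inr_ c (ap u x).
Proof.
move=> xf; rewrite ap_mkhom /theta_fun; case: pickP => [y' /eqP xy|//].
by case: (xf y').
Qed.

Lemma theta_inc (s : hom c c) :
  hom_comp (hom_comp (hom_comp s f0) (inc d b)) theta = hom_comp s (inc c a).
Proof. by apply: homP => i x; rewrite !ap_comp !ap_inc ap_theta_in. Qed.

Lemma theta_outside e (g : hom e (obj_add d b)) : outside g -> outside (hom_comp g theta).
Proof.
move=> [i [x [z gx]]]; exists i, x, (ap u (inr_ d z)).
by rewrite ap_comp gx ap_theta_out // => y /esym/inlrE.
Qed.

(** If no value of [f] lies off the image of [f0], then [f] factors through [f0]; a value off it is
    moved by [theta] into the added block. *)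
Lemma theta_inc_outside e (f : hom e d) : (forall s : hom e c, f <> hom_comp s f0) ->
  outside (hom_comp (hom_comp f (inc d b)) theta).
Proof.
move=> ff0; have [//|[g fg]] := outside_or (hom_comp (hom_comp f (inc d b)) theta).
have [s fs] : exists s, f = hom_comp s f0; last by case: (ff0 s).
apply: hom_factor => i x; case: (EM (exists y, ap f x = ap f0 y)) => // nf.
suff : inr_ c (ap u (inl_ b (ap f x))) = inl_ a (ap g x) by move=> /esym/inlrE.
rewrite -ap_theta_out => [|y /inl_inj fy]; last by case: nf; exists y.
by rewrite -(ap_inc a (ap g x)) -ap_comp -fg !ap_comp ap_inc.
Qed.

End Theta.

End Homs.
Arguments inl_ {m c} a {i} x.
Arguments inr_ {m} c {a i} x.

(** * Submodules and spans *)

Section LinearSpans.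
Variable k : fieldType.

Definition lclosed (X : lmodType k) (P : X -> Prop) :=
  P 0 /\ forall a x y, P x -> P y -> P (a *: x + y).

Section Closed.
Variables (X : lmodType k) (P : X -> Prop) (Pcl : lclosed P).

Lemma lclosedD x y : P x -> P y -> P (x + y).
Proof. by move=> Px Py; rewrite -[x]scale1r; apply: Pcl.2. Qed.

Lemma lclosedZ a x : P x -> P (a *: x).
Proof. by move=> Px; rewrite -[_ *: _]addr0; apply: Pcl.2 => //; exact: Pcl.1. Qed.

Lemma lclosedB x y : P x -> P y -> P (x - y).
Proof. by move=> Px Py; rewrite addrC -scaleN1r; apply: Pcl.2. Qed.

Lemma lclosed_sum (I : finType) (Q : pred I) (F : I -> X) :
  (forall i, Q i -> P (F i)) -> P (\sum_(i | Q i) F i).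
Proof. by apply: big_ind => [|x y]; [exact: Pcl.1 | exact: lclosedD]. Qed.

Lemma lclosed_scaleK a x : a != 0 -> P (a *: x) -> P x.
Proof. by move=> a0 /(lclosedZ a^-1); rewrite scalerA mulVf // scale1r. Qed.

End Closed.

(** [B] plus the span of the [x i] with [i] in [Z]. As [Z] is only a [Prop], the restriction is put
    on the coefficients. *)
Definition lspan (X : lmodType k) (B : X -> Prop) (I : finType) (x : I -> X) (Z : I -> Prop) y :=
  exists b al, [/\ B b, forall i, ~ Z i -> al i = 0 & y = b + \sum_i al i *: x i].

Section Span.
Variables (X : lmodType k) (B : X -> Prop) (Bcl : lclosed B).
Variables (I : finType) (x : I -> X) (Z : I -> Prop).

Lemma lspan_closed : lclosed (lspan B x Z).
Proof.
split.
  exists 0, (fun=> 0); split=> //; first exact: Bcl.1.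
  by rewrite big1 ?addr0 // => i _; rewrite scale0r.
move=> a _ _ [b1 [al1 [Bb1 Z1 ->]]] [b2 [al2 [Bb2 Z2 ->]]].
exists (a *: b1 + b2), (fun i => a * al1 i + al2 i); split.
- exact: Bcl.2.
- by move=> i nZ; rewrite Z1 // Z2 // mulr0 addr0.
- rewrite scalerDr addrACA scaler_sumr -big_split /=; congr (_ + _).
  by apply: eq_bigr => i _; rewrite scalerDl scalerA.
Qed.

Lemma lspan_base y : B y -> lspan B x Z y.
Proof.
move=> By; exists y, (fun=> 0); split=> //.
by rewrite big1 ?addr0 // => i _; rewrite scale0r.
Qed.

Lemma lspan_gen i : Z i -> lspan B x Z (x i).
Proof.
move=> Zi; exists 0, (fun j => (j == i)%:R); split.
- exact: Bcl.1.
- by move=> j nZ; case: eqP => // ji; case: nZ; rewrite ji.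
- rewrite add0r (bigD1 i) //= eqxx scale1r big1 ?addr0 // => j /negPf->.
  by rewrite scale0r.
Qed.

Lemma lspan_min (C : X -> Prop) : lclosed C -> (forall y, B y -> C y) ->
  (forall i, Z i -> C (x i)) -> forall y, lspan B x Z y -> C y.
Proof.
move=> Ccl BC xC _ [b [al [Bb alZ ->]]]; apply: lclosedD => //; first exact: BC.
apply: lclosed_sum => // i _; case: (EM (Z i)) => [/xC|/alZ->]; first exact: lclosedZ.
by rewrite scale0r; exact: Ccl.1.
Qed.

End Span.

Lemma sum_push (X : lmodType k) (I J : finType) (phi : I -> J) (al : I -> k) (u : J -> X) :
  \sum_i al i *: u (phi i) = \sum_j (\sum_(i | phi i == j) al i) *: u j.
Proof.
rewrite (partition_big phi xpredT) //=; apply: eq_bigr => j _.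
by rewrite scaler_suml; apply: eq_bigr => i /eqP->.
Qed.

Lemma sum_inj (X : nmodType) (I J : finType) (phi : I -> J) (P : pred J) (F : J -> X) :
  injective phi -> (forall j, P j -> exists i, phi i = j) ->
  \sum_(j | P j) F j = \sum_(i | P (phi i)) F (phi i).
Proof.
move=> phiI Pphi; transitivity (\sum_(j in [set phi i | i in P \o phi]) F j).
  apply: eq_bigl => j; apply/idP/imsetP => [Pj|[i Pi ->] //].
  by have [i ij] := Pphi j Pj; exists i; rewrite // /in_mem /= ij.
by rewrite big_imset //= => i i' _ _; exact: phiI.
Qed.

(** A subspace of maximal dimension inside [P] is all of [P]: adjoining a further vector of [P]
    would raise the dimension. *)
Lemma lclosed_vspace (vT : vectType k) (P : vT -> Prop) : lclosed P ->
  exists U : {vspace vT}, forall x, x \in U <-> P x.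
Proof.
move=> Pcl; pose Q n := `[< exists U : {vspace vT}, \dim U = n /\ forall x, x \in U -> P x >].
have Q0 : exists n, Q n.
  exists 0%N; apply/asboolP; exists 0%VS; split=> [|x]; first exact: dimv0.
  by rewrite memv0 => /eqP->; exact: Pcl.1.
have Qub n : Q n -> (n <= \dim {:vT})%N.
  by move=> /asboolP[U [<- _]]; exact/dimvS/subvf.
case: (ex_maxnP Q0 Qub) => n /asboolP[U [Un UP]] nmax; exists U => x; split; first exact: UP.
move=> Px; have QU : Q (\dim (U + <[x]>)).
  apply/asboolP; exists (U + <[x]>)%VS; split=> // _ /memv_addP[u Uu [_ /vlineP[a ->] ->]].
  by rewrite addrC; apply: Pcl.2 => //; exact: UP.
have /eqP -> : U == (U + <[x]>)%VS by rewrite eqEdim addvSl Un nmax.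
exact: subvP (addvSr _ _) _ (memv_line x).
Qed.

End LinearSpans.

(** * Submodules of an FI^m-module and chains of sharp generators *)

Section Submodules.
Variables (k : fieldType) (m : nat).
Implicit Types (V W : FImMod k m) (c d e a b : obj m).

Lemma fact0 V c d (f : hom c d) : fact V f 0 = 0.
Proof.
by have := fact_lin f (-1) (0 : V c) 0; rewrite scaler0 addr0 scaleN1r addNr.
Qed.

Lemma factZ V c d (f : hom c d) r (x : V c) : fact V f (r *: x) = r *: fact V f x.
Proof. by rewrite -[r *: x]addr0 fact_lin fact0 addr0. Qed.

Lemma factD V c d (f : hom c d) (x y : V c) : fact V f (x + y) = fact V f x + fact V f y.
Proof. by rewrite -[x in LHS]scale1r fact_lin scale1r. Qed.

Lemma fact_sum V c d (f : hom c d) (I : finType) (P : pred I) (al : I -> k) (x : I -> V c) :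
  fact V f (\sum_(i | P i) al i *: x i) = \sum_(i | P i) al i *: fact V f (x i).
Proof.
elim/big_rec2: _ => [|i y z _ <-]; first exact: fact0.
by rewrite fact_lin.
Qed.

Lemma mor0 V W (p : forall d, V d -> W d) : is_mor p -> forall d, p d 0 = 0.
Proof. by move=> [plin _] d; have := plin d (-1) 0 0; rewrite scaler0 addr0 scaleN1r addNr. Qed.

Lemma mor_sum V W (p : forall d, V d -> W d) : is_mor p ->
  forall d (I : finType) (al : I -> k) (x : I -> V d),
  p d (\sum_i al i *: x i) = \sum_i al i *: p d (x i).
Proof.
move=> pm d I al x; elim/big_rec2: _ => [|i y1 y2 _ <-]; first exact: mor0.
exact: pm.1.
Qed.

Definition sub V := forall d, V d -> Prop.

Definition submod V (B : sub V) :=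
  (forall d, lclosed (B d)) /\ forall c d (f : hom c d) (x : V c), B c x -> B d (fact V f x).

Lemma subP V (B C : sub V) : (forall d x, B d x <-> C d x) -> B = C.
Proof.
move=> BC; apply: functional_extensionality_dep => d; apply: funext => x.
exact/propext.
Qed.

Definition span1 V (B : sub V) c (w : V c) : sub V :=
  fun d => lspan (B d) (fun f : hom c d => fact V f w) (fun=> True).

Lemma span1P V (B : sub V) c (w : V c) d (x : V d) : span1 B w x <->
  exists y (al : hom c d -> k), B d y /\ x = y + \sum_(f : hom c d) al f *: fact V f w.
Proof.
split=> [[y [al [By _ ->]]]|[y [al [By ->]]]]; first by exists y, al.
by exists y, al; split=> // i [].
Qed.

Section Span1.
Variables (V : FImMod k m) (B : sub V) (Bsub : submod B) (c : obj m) (w : V c).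

Lemma span1_base d (x : V d) : B x -> span1 B w x.
Proof. exact: lspan_base. Qed.

Lemma span1_fact d (f : hom c d) : span1 B w (fact V f w).
Proof. by apply: lspan_gen => //; exact: Bsub.1. Qed.

Lemma span1_gen : span1 B w w.
Proof. by have := span1_fact (hom_id c); rewrite fact_id. Qed.

Lemma span1_min (C : sub V) : submod C -> (forall d (x : V d), B x -> C d x) -> C c w ->
  forall d (x : V d), span1 B w x -> C d x.
Proof.
move=> Csub BC Cw d x; apply: lspan_min => [|y|f _]; first exact: Csub.1.
  exact: BC.
exact: Csub.2.
Qed.

Lemma span1_submod : submod (span1 B w).
Proof.
split=> [d|d e f x]; first exact/lspan_closed/Bsub.1.
apply: (lspan_min (C := fun y : V d => span1 B w (fact V f y))) => [|y By|g _].
- have cl : lclosed (@span1 V B c w e) by exact/lspan_closed/Bsub.1.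
  split=> [|a y z Py Pz]; first by rewrite fact0; exact: cl.1.
  by rewrite fact_lin; exact: cl.2.
- by apply: span1_base; exact: Bsub.2.
- by rewrite -fact_comp; exact: span1_fact.
Qed.

End Span1.

Definition elt V := {c : obj m & V c}.

Fixpoint span V (B : sub V) (s : seq (elt V)) : sub V :=
  if s is w :: s' then span (span1 B (tagged w)) s' else B.

Lemma span_cat V (B : sub V) s t : span B (s ++ t) = span (span B s) t.
Proof. by elim: s B => //= w s IH B. Qed.

Lemma span_submod V (B : sub V) s : submod B -> submod (span B s).
Proof. by elim: s B => //= w s IH B Bs; apply: IH; exact: span1_submod. Qed.

Lemma span_base V (B : sub V) s d (x : V d) : B d x -> span B s x.
Proof. by elim: s B => //= w s IH B Bx; apply: IH; exact: span1_base. Qed.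

Lemma span_gen V (B : sub V) s : submod B -> forall w, List.In w s -> span B s (tagged w).
Proof.
elim: s B => //= v s IH B Bs w [<-|ws].
  by apply: span_base; exact: span1_gen.
by apply: IH => //; exact: span1_submod.
Qed.

Lemma span_min V (B : sub V) s (C : sub V) : submod B -> submod C ->
  (forall d (x : V d), B d x -> C d x) -> (forall w, List.In w s -> C _ (tagged w)) ->
  forall d (x : V d), span B s x -> C d x.
Proof.
elim: s B => [|v s IH] B Bs Cs BC sC d x; first exact: BC.
apply: IH => //; first exact: span1_submod.
  by apply: span1_min => //; apply: sC; left.
by move=> w sw; apply: sC; right.
Qed.

(* The relations satisfied by [w] modulo [B] are stable under the partial inverse of
   every [f0], so that the span of [w] modulo [B] is an FI#-module. *)
Definition sharp V (B : sub V) c (w : V c) :=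
  forall d (al : hom c d -> k), B d (\sum_(f : hom c d) al f *: fact V f w) ->
  forall e (f0 : hom e d), B e (\sum_(g : hom c e) al (hom_comp g f0) *: fact V g w).

Fixpoint chain V (B : sub V) (s : seq (elt V)) : Prop :=
  if s is w :: s' then sharp B (tagged w) /\ chain (span1 B (tagged w)) s' else True.

Lemma chain_cat V (B : sub V) s t : chain B s -> chain (span B s) t -> chain B (s ++ t).
Proof. by elim: s B => //= w s IH B [Bw ws] st; split=> //; apply: IH. Qed.

(** Working form of a filtration from [B] to [L]. Sharpness is a condition on relations alone: it
    passes to shifts, and in characteristic 0 it makes the quotients projective. *)
Definition filt V (B L : sub V) := exists s, chain B s /\ span B s = L.

Lemma filt_refl V (B : sub V) : filt B B.
Proof. by exists [::]. Qed.

Lemma filt_trans V (B F L : sub V) : filt B F -> filt F L -> filt B L.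
Proof.
move=> [s [Bs <-]] [t [st <-]]; exists (s ++ t); split; last exact: span_cat.
exact: chain_cat.
Qed.

Lemma filt_sharp V (B : sub V) c (w : V c) : sharp B w -> filt B (span1 B w).
Proof. by move=> Bw; exists [:: existT _ c w]. Qed.

End Submodules.

(** * Projectivity of sharp extensions in characteristic 0 *)

Section CharZero.
Variables (k : fieldType) (m : nat).
Hypothesis char0 : [pchar k] =i pred0.
Implicit Types (V W A B : FImMod k m) (c d e a b : obj m).

Lemma card_endo_neq0 c : #|{: hom c c}|%:R != 0 :> k.
Proof.
have /pcharf0P -> := char0; rewrite -lt0n; by apply/card_gt0P; exists (hom_id c).
Qed.

(** Multiply the sum by the order of [hom c c]. Reindexing by each [s] regroups it as a sum over [f]
    of the parts supported on the image of [f], each the image under [f] of an element of [C].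
    Characteristic 0 allows the division. *)
Lemma avg_closed V (C : sub V) c d (y : V c) (al : hom c d -> k) : submod C ->
  (forall f0 : hom c d, C c (\sum_(s : hom c c) al (hom_comp s f0) *: fact V s y)) ->
  C d (\sum_(f : hom c d) al f *: fact V f y).
Proof.
move=> Csub Cal; apply: (lclosed_scaleK (Csub.1 d) (card_endo_neq0 c)).
have -> : #|{: hom c c}|%:R *: \sum_(f : hom c d) al f *: fact V f y =
    \sum_(f : hom c d) 1 *: fact V f (\sum_(s : hom c c) al (hom_comp s f) *: fact V s y).
  rewrite scaler_nat -sumr_const; under [RHS]eq_bigr do rewrite scale1r fact_sum.
  rewrite [RHS]exchange_big /=; apply: eq_bigr => s _.
  rewrite (reindex_inj (hom_precomp_inj (s := s))) /=.
  by apply: eq_bigr => f _; rewrite fact_comp.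
apply: lclosed_sum => [|f _]; first exact: Csub.1.
by apply: lclosedZ => //; [exact: Csub.1 | exact: Csub.2].
Qed.

(* Maschke: average over [hom c c] a linear section defined on the span of the orbit of [b]. *)
Lemma equivariant_lift A B (p : forall d, A d -> B d) c (b : B c) : is_mor p ->
  (forall d (y : B d), exists x, p d x = y) ->
  exists y : A c, p c y = b /\ forall al : hom c c -> k,
    \sum_(s : hom c c) al s *: fact B s b = 0 -> \sum_(s : hom c c) al s *: fact A s y = 0.
Proof.
move=> pmor psurj; have [plin pnat] := pmor.
pose G := hom c c; pose E := {ffun G -> k^o}.
pose ev (al : E) : B c := \sum_s (al s : k) *: fact B s b.
have evlin r x y : ev (r *: x + y) = r *: ev x + ev y.
  rewrite /ev scaler_sumr -big_split /=; apply: eq_bigr => s _.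
  by rewrite !ffunE scalerDl scalerA.
have [U UP] : exists U : {vspace E}, forall al, al \in U <-> ev al = 0.
  apply: lclosed_vspace; split=> [|r x y x0 y0].
    by rewrite /ev big1 // => s _; rewrite ffunE scale0r.
  by rewrite evlin x0 y0 scaler0 addr0.
(* [q] projects the group algebra along the relations [U] of [b], so [t] below is a linear lift of
   [ev] that vanishes on [U]. *)
pose q al := al - projv U al.
have qlin r x y : q (r *: x + y) = r *: q x + q y.
  by rewrite /q linearP scalerBr opprD addrACA.
have qU al : al \in U -> q al = 0 by move=> Ual; rewrite /q projv_id ?subrr.
have evq al : ev (q al) = ev al.
  rewrite /q addrC -scaleN1r evlin; have /UP-> := memv_proj U al.
  by rewrite scaler0 add0r.
pose z s := projT1 (cid (psurj c (fact B s b))).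
have pz s : p c (z s) = fact B s b := projT2 (cid (psurj c (fact B s b))).
pose t al := \sum_s (q al s : k) *: z s.
have tlin r x y : t (r *: x + y) = r *: t x + t y.
  rewrite /t scaler_sumr -big_split /=; apply: eq_bigr => s _.
  by rewrite qlin !ffunE scalerDl scalerA.
have t0 : t 0 = 0 by have := tlin (-1) 0 0; rewrite scaler0 addr0 scaleN1r addNr.
have tsum (I : finType) (al : I -> k) (x : I -> E) :
    t (\sum_i al i *: x i) = \sum_i al i *: t (x i).
  by elim/big_rec2: _ => [|i y1 y2 _ <-].
have pt al : p c (t al) = ev al.
  by rewrite /t mor_sum // -[RHS]evq; apply: eq_bigr => s _; rewrite pz.
have tU al : al \in U -> t al = 0.
  by move=> /qU q0; rewrite /t big1 // => s _; rewrite q0 ffunE scale0r.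
pose inv (g : G) := projT1 (cid (hom_linv g)).
have invE (g : G) : hom_comp (inv g) g = hom_id c := projT2 (cid (hom_linv g)).
have invE' (g : G) : hom_comp g (inv g) = hom_id c.
  by apply: (hom_comp_inj (g := g)); rewrite -hom_compA invE hom_comp_id hom_id_comp.
pose de (g : G) : E := [ffun s => (s == g)%:R].
have evde g : ev (de g) = fact B g b.
  rewrite /ev (bigD1 g) //= ffunE eqxx scale1r big1 ?addr0 // => s /negPf sg.
  by rewrite ffunE sg scale0r.
pose n := #|{: G}|%:R : k; have n0 : n != 0 by exact: card_endo_neq0.
(* Averaging the conjugates of [t] makes it equivariant; [S] is the value at the identity, before
   division by [n]. *)
pose S := \sum_(g : G) (1 : k) *: fact A g (t (de (inv g))).
exists (n^-1 *: S); split.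
  have -> : n^-1 *: S = \sum_(g : G) n^-1 *: fact A g (t (de (inv g))).
    by rewrite scaler_sumr; apply: eq_bigr => g _; rewrite scale1r.
  rewrite mor_sum //; under eq_bigr => g _ do rewrite pnat pt evde -fact_comp invE fact_id.
  by rewrite sumr_const -[_ *+ _]scaler_nat scalerA mulfV // scale1r.
move=> al al0; under eq_bigr => s _ do rewrite factZ.
under eq_bigr => s _ do rewrite scalerA mulrC -scalerA.
rewrite -scaler_sumr; suff -> : \sum_s al s *: fact A s S = 0 by rewrite scaler0.
(* [be g] is the translate of [al] by the inverse of [g]: again a relation of [b], hence killed by
   [t]. *)
pose be (g : G) : E := \sum_s al s *: de (hom_comp s (inv g)).
transitivity (\sum_(g : G) fact A g (t (be g))).
  under eq_bigr => s _ do rewrite /S fact_sum scaler_sumr.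
  under [RHS]eq_bigr => g _ do rewrite tsum fact_sum.
  rewrite [RHS]exchange_big /=; apply: eq_bigr => s _.
  rewrite [RHS](reindex_inj (hom_comp_inj (g := s))) /=; apply: eq_bigr => g _.
  rewrite scale1r fact_comp; congr (_ *: fact A _ (fact A _ (t (de _)))).
  by apply: (hom_precomp_inj (s := g)); rewrite invE' hom_compA invE'.
rewrite big1 // => g _; rewrite tU ?fact0 //; apply/UP.
have evsum (I : finType) (a' : I -> k) (x : I -> E) :
    ev (\sum_i a' i *: x i) = \sum_i a' i *: ev (x i).
  elim/big_rec2: _ => [|i y1 y2 _ <-]; last exact: evlin.
  by have := evlin (-1) 0 0; rewrite scaler0 addr0 scaleN1r addNr.
rewrite evsum; under eq_bigr => s _ do rewrite evde fact_comp.
by rewrite -fact_sum al0 fact0.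
Qed.

Definition zero_sub V : sub V := fun d x => x = 0.
Arguments zero_sub V [d] x.

Lemma zero_submod V : submod (zero_sub V).
Proof.
split=> [d|c d f x ->]; last exact: fact0.
by split=> // a x y -> ->; rewrite scaler0 addr0.
Qed.

(** By sharpness and averaging, all relations of [w] modulo [F] follow from those in degree [c]. So
    a lift [y] of [phi c w] that respects the latter defines [psi] by sending each [f w] to
    [f y]. *)
Lemma sharp_projective V (F : sub V) c (w : V c) : submod F -> sharp F w ->
  projective_subquotient (span1 F w) F.
Proof.
move=> Fsub Fw A B p pmor psurj phi [philin phi0 phinat].
have [plin pnat] := pmor.
have Fw_sub := span1_submod Fsub w.
have phisum d (al : hom c d -> k) :
    phi d (\sum_(f : hom c d) al f *: fact V f w) = \sum_(f : hom c d) al f *: fact B f (phi c w).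
  suff [] : span1 F w (\sum_(f : hom c d) al f *: fact V f w) /\
     phi d (\sum_(f : hom c d) al f *: fact V f w) = \sum_(f : hom c d) al f *: fact B f (phi c w)
    by [].
  elim/big_rec2: _ => [|f y1 y2 _ [Fy IH]].
    by split; [exact: (Fw_sub.1 d).1 | apply: phi0; exact: (Fsub.1 d).1].
  have Ff : span1 F w (fact V f w) by exact: span1_fact.
  split; first exact: (Fw_sub.1 d).2.
  by rewrite philin // IH phinat //; exact: span1_gen.
have [y [py yrel]] := equivariant_lift (phi c w) pmor psurj.
have rel0 d (al : hom c d -> k) : F d (\sum_(f : hom c d) al f *: fact V f w) ->
    \sum_(f : hom c d) al f *: fact A f y = 0.
  move=> Fal; apply: (avg_closed (zero_submod A)) => f0; apply: yrel.
  by rewrite -phisum; apply: phi0; exact: Fw.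
(* The graph of [psi]. The coefficients [al] are not unique, but [rel0] makes it single valued. *)
pose R d (x : V d) (z : A d) := exists (t : V d) (al : hom c d -> k),
  [/\ F d t, x = t + \sum_(f : hom c d) al f *: fact V f w
    & z = \sum_(f : hom c d) al f *: fact A f y].
have Rfun d x z z' : R d x z -> R d x z' -> z = z'.
  move=> [t [al [Ft -> ->]]] [t' [al' [Ft' E ->]]]; apply/eqP; rewrite -subr_eq0; apply/eqP.
  rewrite -sumrB; under eq_bigr do rewrite -scalerBl; apply: rel0.
  have -> : \sum_(f : hom c d) (al f - al' f) *: fact V f w = t' - t.
    under eq_bigr do rewrite scalerBl; rewrite sumrB; apply/eqP.
    by rewrite subr_eq addrAC eq_sym subr_eq -E addrC.
  exact: (lclosedB (Fsub.1 d)).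
have Rex d (x : V d) : span1 F w x -> exists z, R d x z.
  by move=> /span1P[t [al [Ft xE]]]; exists (\sum_(f : hom c d) al f *: fact A f y), t, al.
(* The value 0 off [span1 F w] is arbitrary: [quot_hom] constrains [psi] only on [span1 F w]. *)
pose psi d (x : V d) : A d :=
  if pselect (exists z, R d x z) is left ex then projT1 (cid ex) else 0.
have psiR d x z : R d x z -> psi d x = z.
  rewrite /psi; case: pselect => [ex|nex Rz]; last by case: nex; exists z.
  by apply: Rfun; exact: projT2 (cid ex).
exists psi; split; first split.
- move=> d r x1 x2 /Rex[z1 Rz1] /Rex[z2 Rz2]; rewrite (psiR _ _ _ Rz1) (psiR _ _ _ Rz2).
  apply: psiR; case: Rz1 Rz2 => [t1 [al1 [Ft1 -> ->]]] [t2 [al2 [Ft2 -> ->]]].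
  exists (r *: t1 + t2), (fun f => r * al1 f + al2 f); split; first exact: (Fsub.1 d).2.
    rewrite scalerDr addrACA scaler_sumr -big_split /=; congr (_ + _).
    by apply: eq_bigr => i _; rewrite scalerDl scalerA.
  rewrite scaler_sumr -big_split /=.
  by apply: eq_bigr => i _; rewrite scalerDl scalerA.
- move=> d x Fx; apply: psiR; exists x, (fun=> 0); split=> //.
    by rewrite big1 ?addr0 // => i _; rewrite scale0r.
  by rewrite big1 // => i _; rewrite scale0r.
- move=> d e f x /Rex[z Rz]; rewrite (psiR _ _ _ Rz); apply: psiR.
  case: Rz => [t [al [Ft -> ->]]].
  exists (fact V f t), (fun g => \sum_(g' | hom_comp g' f == g) al g'); split.
  + exact: Fsub.2.
  + rewrite factD fact_sum -(sum_push (fun g => hom_comp g f) al (fun g => fact V g w)).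
    by under eq_bigr do rewrite -fact_comp.
  + rewrite fact_sum -(sum_push (fun g => hom_comp g f) al (fun g => fact A g y)).
    by under eq_bigr do rewrite -fact_comp.
- move=> d x /[dup] Sx /Rex[z Rz]; rewrite (psiR _ _ _ Rz).
  case: Rz => [t [al [Ft xE ->]]].
  have -> : phi d x = phi d (\sum_(f : hom c d) al f *: fact V f w).
    have Salw : span1 F w (\sum_(f : hom c d) al f *: fact V f w).
      rewrite -[X in span1 F w X](addKr t) -xE addrC.
      by apply: (lclosedB (Fw_sub.1 d)) => //; exact: span1_base.
    have St : span1 F w t by exact: span1_base.
    by rewrite xE -[t]scale1r philin // (phi0 _ _ Ft) scaler0 add0r.
  rewrite phisum.
  by rewrite mor_sum //; apply: eq_bigr => f _; rewrite pnat py.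
Qed.

End CharZero.
Arguments zero_sub {k m} V [d] x.

(** * Shifts of sharp extensions *)

Section Shift.
Variables (k : fieldType) (m : nat).
Implicit Types (V : FImMod k m) (c d e a b : obj m).

(** Each point of [e] is hit by [h], so its image under [f] lies in the image of [f0]. Hence the
    factorization of [hom_shift_factor] is unique up to relabelling [e]. *)
Lemma onto_shift_factor c d e e' b (h : hom c (obj_add e b)) (f : hom e d)
    (g : hom c (obj_add e' b)) (f0 : hom e' d) : onto h ->
  hom_comp g (hom_shift b f0) = hom_comp h (hom_shift b f) ->
  exists2 f', f = hom_comp f' f0 & g = hom_comp h (hom_shift b f').
Proof.
move=> hon gh; have [f' ff'] : exists f', f = hom_comp f' f0.
  apply: hom_factor => i y; have [x hx] := hon i y.
  have : ap (hom_shift b f0) (ap g x) = inl_ b (ap f y).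
    by rewrite -ap_comp gh ap_comp hx ap_shiftl.
  case: (splitV (ap g x)) => z; last by rewrite ap_shiftr => /esym/inlrE.
  by rewrite ap_shiftl => /inl_inj <-; exists z.
exists f' => //; apply: (hom_comp_inj (g := hom_shift b f0)).
by rewrite /= gh ff' hom_shift_comp hom_compA.
Qed.

Definition shsub V b (B : sub V) : sub (shift_mod V b) :=
  fun d (x : shift_mod V b d) => B (obj_add d b) x.
Arguments shsub {V} b B [d] x.

Lemma shsub_submod V b (B : sub V) : submod B -> submod (shsub b B).
Proof. by move=> Bs; split=> [d|c d f x]; [exact: Bs.1 | exact: Bs.2]. Qed.

Section Gspan.
Variables (V : FImMod k m) (b c : obj m) (B : sub V) (w : V c).
Hypothesis Bsub : submod B.
Implicit Type Z : forall d, hom c (obj_add d b) -> Prop.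

(** Describes a piece of the shift by a set [Z] of injections out of [c], so that questions about
    submodules between the shifts of [B] and [span1 B w] become combinatorial. *)
Definition gspan Z : sub (shift_mod V b) :=
  fun d => lspan (B (d := obj_add d b)) (fun g : hom c (obj_add d b) => fact V g w) (@Z d).

Definition generated_by (s : seq {e : obj m & hom c (obj_add e b)}) d (g : hom c (obj_add d b)) :=
  exists x, List.In x s /\ exists f : hom (tag x) d, g = hom_comp (tagged x) (hom_shift b f).

Definition shift_elt (x : {e : obj m & hom c (obj_add e b)}) : elt (shift_mod V b) :=
  existT (fun d => shift_mod V b d : Type) (tag x) (fact V (tagged x) w).

Definition elts_of s := [seq shift_elt x | x <- s].

Lemma In_elts_of s v : List.In v (elts_of s) -> exists x, List.In x s /\
v = shift_elt x.
Proof.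
elim: s => //= x s IH [<-|/IH[y [sy ->]]]; first by exists x; split=> //; left.
by exists y; split=> //; right.
Qed.

Lemma gspan_base Z d (x : shift_mod V b d) : shsub b B x -> gspan Z x.
Proof. exact: lspan_base. Qed.

Lemma gspan_gen Z d (g : hom c (obj_add d b)) : Z d g -> @gspan Z d (fact V g w).
Proof. by move=> Zg; exact: (lspan_gen (Bsub.1 _) (fun g => fact V g w)). Qed.

Lemma gspan_min Z d (C : V (obj_add d b) -> Prop) : lclosed C -> (forall x, B x -> C x) ->
  (forall g, Z d g -> C (fact V g w)) -> forall x, gspan Z x -> C x.
Proof. by move=> Ccl BC ZC x; exact: lspan_min. Qed.

Lemma gspan_submod Z :
  (forall d d' (g : hom c (obj_add d b)) (f : hom d d'),
    Z d g -> Z d' (hom_comp g (hom_shift b f))) ->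
  submod (gspan Z).
Proof.
move=> Zst; have cl d : lclosed (@gspan Z d) by exact/lspan_closed/Bsub.1.
split=> // d e f x; apply: (gspan_min (C := fun y => gspan Z (fact (shift_mod V b) f y))).
- split=> [|a y z Py Pz]; first by rewrite fact0; exact: (cl e).1.
  by rewrite fact_lin; exact: (cl e).2.
- by move=> y By; apply: gspan_base; exact: (shsub_submod b Bsub).2.
- by move=> g Zg; rewrite /= -fact_comp; apply: gspan_gen; exact: Zst.
Qed.

Lemma generated_by_stable s d d' (g : hom c (obj_add d b)) (f : hom d d') :
  generated_by s g -> generated_by s (hom_comp g (hom_shift b f)).
Proof.
move=> [x [sx [f' ->]]]; exists x; split=> //; exists (hom_comp f' f).
by rewrite hom_shift_comp hom_compA.
Qed.

Lemma span_elts_of s : span (shsub b B) (elts_of s) = gspan (generated_by s).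
Proof.
have Bb := shsub_submod b Bsub.
have Ss : submod (span (shsub b B) (elts_of s)) by exact: span_submod.
apply: subP => d x; split.
  move: d x; apply: span_min => //.
  - exact/gspan_submod/generated_by_stable.
  - exact: gspan_base.
  - move=> _ /In_elts_of[x [sx ->]]; apply: gspan_gen; exists x; split=> //.
    by exists (hom_id (tag x)); rewrite hom_shift_id hom_comp_id.
move: x; apply: gspan_min => [|x Bx|_ [x [sx [f ->]]]]; first exact: Ss.1.
  exact: span_base.
have := Ss.2 _ _ f _ (span_gen Bb (List.in_map _ _ _ sx)).
by rewrite /= -fact_comp.
Qed.

(** A relation of [h0 w] modulo [gspan Z] is a relation of [w] modulo [B], up to a correction
    supported in [Z]. Sharpness of [w] restricts it along the shift of [f0], and the condition on
    [Z] keeps the restricted correction in [gspan Z]. *)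
Lemma sharp_gspan Z e0 (h0 : hom c (obj_add e0 b)) : sharp B w ->
  (forall d e (f0 : hom e d) g, Z d (hom_comp g (hom_shift b f0)) -> Z e g) ->
  onto h0 -> sharp (gspan Z) (fact V h0 w : shift_mod V b e0).
Proof.
move=> Bw Zsh h0on d al [y [A [By AZ E]]] e f0.
(* [al] pushed forward along [h0], minus the correction [A]. *)
pose C (g : hom c (obj_add d b)) := \sum_(f | hom_comp h0 (hom_shift b f) == g) al f - A g.
have : B (\sum_g C g *: fact V g w).
  suff -> : \sum_g C g *: fact V g w = y by [].
  under eq_bigr do rewrite /C scalerBl.
  rewrite sumrB; apply/eqP; rewrite subr_eq; apply/eqP; rewrite -E.
  rewrite -(sum_push (fun f => hom_comp h0 (hom_shift b f)) al (fun g => fact V g w)).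
  by apply: eq_bigr => f _; rewrite fact_comp.
move=> /Bw /(_ _ (hom_shift b f0)) BC.
exists (\sum_(g : hom c (obj_add e b)) C (hom_comp g (hom_shift b f0)) *: fact V g w),
  (fun g => A (hom_comp g (hom_shift b f0))); split=> // [g nZ|].
  by apply: AZ => /Zsh.
under [in RHS]eq_bigr do rewrite /C scalerBl.
rewrite sumrB subrK.
transitivity (\sum_(f : hom e0 e) al (hom_comp f f0) *: fact V (hom_comp h0 (hom_shift b f)) w).
  by apply: eq_bigr => f _; rewrite fact_comp.
rewrite (sum_push (fun f => hom_comp h0 (hom_shift b f)) (fun f => al (hom_comp f f0))
  (fun g => fact V g w)).
(* Pushing forward commutes with restriction along [f0] because [h0] is [onto]. *)
apply: eq_bigr => g _; congr (_ *: _); rewrite [RHS](sum_inj _ (hom_comp_inj (g := f0))).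
  apply: eq_bigl => f; rewrite hom_shift_comp hom_compA.
  by rewrite (inj_eq (hom_comp_inj (g := hom_shift b f0))).
move=> f /eqP/esym/(onto_shift_factor h0on)[f' -> _]; by exists f'.
Qed.

(** Adjoin one generator at a time. As the earlier ones are [onto], a map whose composite with a
    shifted injection is generated by them is itself generated by them, which is the condition on
    [Z] in [sharp_gspan]. *)
Lemma filt_gspan s : sharp B w -> (forall x, List.In x s -> onto (tagged x)) ->
  filt (shsub b B) (gspan (generated_by s)).
Proof.
move=> Bw; elim/last_ind: s => [|s x IH] son.
  suff <- : span (shsub b B) (elts_of [::]) = gspan (generated_by [::]) by exact: filt_refl.
  exact: span_elts_of.
have sonx y : List.In y s -> List.In y (rcons s x).
  by rewrite -cats1 => sy; apply: List.in_or_app; left.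
apply: filt_trans (IH _) _ => [y sy|]; first by apply: son; exact: sonx.
rewrite -!span_elts_of -cats1 /elts_of map_cat span_cat -/(elts_of s) /=.
apply: filt_sharp; rewrite span_elts_of; apply: sharp_gspan => //.
  move=> d e f0 g [y [sy [f /onto_shift_factor]]] [|f' _ ->]; first exact/son/sonx.
  by exists y; split=> //; exists f'.
by apply: son; rewrite -cats1; apply: List.in_or_app; right; left.
Qed.

End Gspan.

Lemma gspan_full V b c (B : sub V) (w : V c) Z : (forall d g, Z d g) ->
  gspan B w Z = shsub b (span1 B w).
Proof.
move=> Zall; apply: subP => d x; split.
  move=> [y [al [By _ ->]]]; apply/span1P.
  by exists y, al.
by move=> /span1P[y [al [By ->]]]; exists y, al; split=> // g [].
Qed.

Lemma filt_shsub1 V b c (B : sub V) (w : V c) : submod B -> sharp B w ->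
  filt (shsub b B) (shsub b (span1 B w)).
Proof.
move=> Bs Bw; have [s sP] := enum_shift_homs c b.
pose t := [seq x <- s | `[< onto (tagged x) >]].
have <- : gspan B w (@generated_by b c t) = shsub b (span1 B w).
  apply: gspan_full => d g; have [e [h [f [hon <-]]]] := hom_shift_factor g.
  exists (existT _ e h); split; last by exists f.
  by apply/In_filter; split; [exact/sP/(onto_le hon) | exact/asboolP].
by apply: filt_gspan => // x /In_filter[_ /asboolP].
Qed.

Lemma filt_shsub V b (B L : sub V) : submod B -> filt B L -> filt (shsub b B) (shsub b L).
Proof.
move=> Bs [s [sc <-]]; elim: s B Bs sc => [|w s IH] B Bs /=; first by move=> _; exact: filt_refl.
move=> [Bw ch]; apply: filt_trans (filt_shsub1 b Bs Bw) _; apply: IH => //.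
exact: span1_submod.
Qed.

End Shift.
Arguments shsub {k m V} b B [d] x.

(** * Filtering a shift *)

Section Transport.
Variables (k : fieldType) (m : nat).
Implicit Types (V W : FImMod k m) (c d e a b : obj m).

Lemma filt_img V W (p : forall d, V d -> W d) : is_mor p -> (forall d, injective (p d)) ->
  forall B L : sub V, filt B L ->
  filt (fun d y => exists2 x, B d x & p d x = y) (fun d y => exists2 x, L d x & p d x = y).
Proof.
move=> pm pinj B L [s [sc <-]]; elim: s B sc => [|[c w] s IH] B /=.
  by move=> _; exact: filt_refl.
move=> [Bw /IH]; apply: filt_trans.
have -> : (fun d y => exists2 x, span1 B w x & p d x = y) =
    span1 (fun d y => exists2 x, B d x & p d x = y) (p c w).
  apply: subP => d y; split.
    move=> [_ /span1P[x [al [Bx ->]]] <-]; apply/span1P.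
    exists (p d x), al; split; first by exists x.
    rewrite -[x]scale1r pm.1 !scale1r mor_sum //; congr (_ + _).
    by apply: eq_bigr => f _; rewrite pm.2.
  move=> /span1P[_ [al [[x Bx <-] ->]]]; exists (x + \sum_(f : hom c d) al f *: fact V f w).
    by apply/span1P; exists x, al.
  rewrite -[x]scale1r pm.1 !scale1r mor_sum //; congr (_ + _).
  by apply: eq_bigr => f _; rewrite pm.2.
apply: filt_sharp => d al [x Bx xE] e f0.
exists (\sum_(g : hom c e) al (hom_comp g f0) *: fact V g w).
  apply: Bw; suff <- : x = \sum_(f : hom c d) al f *: fact V f w by [].
  by apply: pinj; rewrite xE mor_sum //; apply: eq_bigr => f _; rewrite pm.2.
by rewrite mor_sum //; apply: eq_bigr => f _; rewrite pm.2.
Qed.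

Lemma assoc_inj d a b i :
  injective (cast_ord (esym (addnA (d i) (a i) (b i))) : _ -> 'I_(obj_add d (obj_add a b) i)).
Proof. exact: cast_ord_inj. Qed.

(** The two objects are equal but not convertible, so iterated shifts are compared through a cast on
    points. *)
Definition assoc d a b : hom (obj_add (obj_add d a) b) (obj_add d (obj_add a b)) :=
  mkhom (@assoc_inj d a b).

Lemma unassoc_inj d a b i :
  injective (cast_ord (addnA (d i) (a i) (b i)) : _ -> 'I_(obj_add (obj_add d a) b i)).
Proof. exact: cast_ord_inj. Qed.

Definition unassoc d a b : hom (obj_add d (obj_add a b)) (obj_add (obj_add d a) b) :=
  mkhom (@unassoc_inj d a b).

Lemma assocK d a b : hom_comp (assoc d a b) (unassoc d a b) = hom_id _.
Proof. by apply: homP => i x; rewrite ap_comp !ap_mkhom ap_id; exact: val_inj. Qed.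

Lemma unassocK d a b : hom_comp (unassoc d a b) (assoc d a b) = hom_id _.
Proof. by apply: homP => i x; rewrite ap_comp !ap_mkhom ap_id; exact: val_inj. Qed.

Lemma assoc_natural c d a b (f : hom c d) :
  hom_comp (hom_shift b (hom_shift a f)) (assoc d a b) =
  hom_comp (assoc c a b) (hom_shift (obj_add a b) f).
Proof.
have all_ e i (x : 'I_(e i)) : ap (assoc e a b) (inl_ b (inl_ a x)) = inl_ (obj_add a b) x.
  by rewrite ap_mkhom; exact: val_inj.
have alr e i (x : 'I_(a i)) : ap (assoc e a b) (inl_ b (inr_ e x)) = inr_ e (inl_ b x).
  by rewrite ap_mkhom; exact: val_inj.
have arr e i (x : 'I_(b i)) : ap (assoc e a b) (inr_ (obj_add e a) x) = inr_ e (inr_ a x).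
  by rewrite ap_mkhom; apply: val_inj => /=; rewrite addnA.
apply: homP => i x; rewrite !ap_comp; case: (splitV x) => y.
  by case: (splitV y) => z; rewrite !ap_shiftl ?ap_shiftr ?all_ ?alr ?ap_shiftl ?ap_shiftr.
by rewrite ap_shiftr !arr ap_shiftr.
Qed.

Lemma filt_shsub_add V a b (B L : sub V) : submod B -> submod L ->
  filt (shsub a (shsub b B)) (shsub a (shsub b L)) ->
  filt (shsub (obj_add a b) B) (shsub (obj_add a b) L).
Proof.
move=> Bs Ls.
pose p d : shift_mod (shift_mod V b) a d -> shift_mod V (obj_add a b) d := fact V (assoc d a b).
have pm : is_mor p.
  split=> [d r x y|c d f x]; first exact: (fact_lin (f0 := V)).
  by rewrite /p /= -!fact_comp -assoc_natural.
have pinj d : injective (p d).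
  apply: (can_inj (g := fact V (unassoc d a b))) => x.
  by rewrite /p -fact_comp assocK fact_id.
have pE (C : sub V) : submod C ->
    (fun d y => exists2 x, shsub a (shsub b C) (d := d) x & p d x = y) = shsub (obj_add a b) C.
  move=> Cs; apply: subP => d y; split=> [[x Cx <-]|Cy]; first exact: Cs.2.
  exists (fact V (unassoc d a b) y); first exact: Cs.2.
  by rewrite /p -fact_comp unassocK fact_id.
by move=> /(filt_img pm pinj); rewrite !pE.
Qed.

(** A further shift preserves a filtration, so shifts found for separate steps can be replaced by
    their sum. *)
Lemma filt_shsub_addl V a b (B L : sub V) : submod B -> submod L ->
  filt (shsub b B) (shsub b L) -> filt (shsub (obj_add a b) B) (shsub (obj_add a b) L).
Proof.
move=> Bs Ls bL; apply: filt_shsub_add => //.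
by apply: filt_shsub => //; exact: shsub_submod.
Qed.

Lemma obj_addC a b : obj_add a b = obj_add b a.
Proof. by apply: funext => i; exact: addnC. Qed.

End Transport.

(** * The top quotient of a shifted cyclic extension *)

Section Main.
Variables (k : fieldType) (m : nat).
Hypothesis char0 : [pchar k] =i pred0.
Implicit Types (V W : FImMod k m) (c d e a b : obj m).

Definition lower V b c (B : sub V) (w : V c) : sub (shift_mod V b) :=
  gspan B w (fun d (g : hom c (obj_add d b)) => outside g).

Lemma outside_stable b c d d' (g : hom c (obj_add d b)) (f : hom d d') :
  outside g -> outside (hom_comp g (hom_shift b f)).
Proof. by move=> [i [x [z gx]]]; exists i, x, z; rewrite ap_comp gx ap_shiftr. Qed.

Lemma lower_submod V b c (B : sub V) (w : V c) : submod B -> submod (lower (b := b) B w).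
Proof. by move=> Bs; apply: gspan_submod => // d d' g f; exact: outside_stable. Qed.

Section TopSharp.
Variables (V : FImMod k m) (c : obj m) (B : sub V) (w : V c).
Hypothesis Bsub : submod B.

(** Relations of the top quotient of the shift by [a], in its generating degree [c]. *)
Definition toprel a (al : hom c c -> k) :=
  @lower V a c B w c (\sum_(s : hom c c) al s *: fact V (hom_comp s (inc c a)) w).

(** Apply [theta]: the [f] that factor through [f0] become maps into the unshifted part, and all
    others are moved into the added block, hence into [lower]. Modulo [lower] only the part on the
    image of [f0] remains. *)
Lemma toprel_theta d a b (f0 : hom c d) (u : hom (obj_add d b) a) (al : hom c d -> k) :
  @lower V b c B w d (\sum_(f : hom c d) al f *: fact V (hom_comp f (inc d b)) w) ->
  toprel a (fun s => al (hom_comp s f0)).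
Proof.
have Ls b' := lower_submod b' w Bsub.
move=> Lal; have : @lower V a c B w c (fact V (theta f0 u)
    (\sum_(f : hom c d) al f *: fact V (hom_comp f (inc d b)) w)).
  move: Lal; apply: (gspan_min (C := fun y => @lower V a c B w c (fact V (theta f0 u) y))).
  - split=> [|r x y Px Py]; first by rewrite fact0; exact: ((Ls a).1 c).1.
    by rewrite fact_lin; exact: ((Ls a).1 c).2.
  - by move=> x Bx; apply: gspan_base; exact: Bsub.2.
  - by move=> g gout; rewrite -fact_comp; apply: gspan_gen => //; exact: theta_outside.
rewrite fact_sum (bigID (fun f => `[< exists s, f = hom_comp s f0 >])) /=.
set S1 := (X in X + _); set S2 := (X in _ + X) => S12.
have S2L : @lower V a c B w c S2.
  apply: lclosed_sum => [|f /asboolPn nf]; first exact: (Ls a).1.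
  apply: lclosedZ; first exact: (Ls a).1.
  rewrite -fact_comp; apply: gspan_gen => //; apply: theta_inc_outside => s fs.
  by apply: nf; exists s.
have S1L : @lower V a c B w c S1.
  by rewrite -[S1](addrK S2); apply: lclosedB => //; exact: (Ls a).1.
rewrite /toprel.
suff <- : S1 = \sum_(s : hom c c) al (hom_comp s f0) *: fact V (hom_comp s (inc c a)) w by [].
rewrite /S1 (sum_inj _ (hom_comp_inj (c := c) (g := f0))); last first.
  by move=> f /asboolP[s ->]; exists s.
apply: eq_big => [s|s _]; first by apply/asboolP; exists s.
by rewrite -fact_comp theta_inc.
Qed.

Lemma toprel_closed a : lclosed (fun al : {ffun hom c c -> k^o} => toprel a al).
Proof.
have Lcl := (lower_submod a w Bsub).1 c; split=> [|r al be Pal Pbe].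
  by rewrite /toprel big1 => [|s _]; [exact: Lcl.1 | rewrite ffunE scale0r].
rewrite /toprel; under eq_bigr do rewrite !ffunE scalerDl -scalerA.
by rewrite big_split /= -scaler_sumr; apply: Lcl.2.
Qed.

Lemma toprel_ext a (al be : hom c c -> k) : al =1 be -> toprel a al -> toprel a be.
Proof. by move=> /funext->. Qed.

(** The relations form a subspace of the group algebra of [hom c c]; take a shift [b] for which its
    dimension is greatest. *)
Lemma toprel_stable : exists b, forall d (f : hom c d) (al : hom c c -> k),
  toprel (obj_add d b) al -> toprel b al.
Proof.
pose E := {ffun hom c c -> k^o}.
pose Q n := `[< exists a (U : {vspace E}), \dim U = n /\ forall al, al \in U <-> toprel a al >].
have Q0 : exists n, Q n.
  have [U UP] := lclosed_vspace (toprel_closed c).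
  by exists (\dim U); apply/asboolP; exists c, U.
have Qub n : Q n -> (n <= \dim {:E})%N.
  by move=> /asboolP[a [U [<- _]]]; exact/dimvS/subvf.
case: (ex_maxnP Q0 Qub) => n /asboolP[b [U [Un UP]]] nmax; exists b => d f al.
have [U' UP'] := lclosed_vspace (toprel_closed (obj_add d b)).
have UU' : (U <= U')%VS.
  apply/subvP => be /UP beb; apply/UP'.
  (* With [f0] the identity and [u] the shift of [f], [theta] only enlarges the added block, so
     relations persist. *)
  have : toprel (obj_add d b) (fun s => be (hom_comp s (hom_id c))).
    apply: (toprel_theta (b := b)); first exact: hom_shift.
    exact: beb.
  by apply: toprel_ext => s; rewrite hom_comp_id.
have /eqP UE : U == U'.
  by rewrite eqEdim UU' Un nmax //; apply/asboolP; exists (obj_add d b), U'.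
pose al' : E := [ffun s => al s].
have ext a : toprel a al <-> toprel a al' by split; apply: toprel_ext => s; rewrite ffunE.
by move=> /ext/UP'; rewrite -UE => /UP/ext.
Qed.

Lemma top_sharp : exists b, sharp (@lower V b c B w) (fact V (inc c b) w : shift_mod V b c).
Proof.
have [b bst] := toprel_stable; exists b => d al Lal e f0.
have {}Lal : @lower V b c B w d (\sum_(f : hom c d) al f *: fact V (hom_comp f (inc d b)) w).
  by move: Lal; under eq_bigr do rewrite /= -fact_comp -inc_natural.
(* It suffices to restrict the relation to the image of one [g] at a time. *)
apply: (avg_closed char0 (lower_submod _ w Bsub)) => g.
(* Isolating the image of [hom_comp g f0] takes a new block with room for all of [obj_add d b];
   stability then returns to the shift by [b]. *)
have := toprel_theta (a := obj_add d b) (hom_comp g f0) (hom_id _) Lal.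
move=> /(bst _ (hom_comp g f0)); rewrite /toprel.
under eq_bigr do rewrite inc_natural fact_comp.
by under [X in _ -> lower B w X]eq_bigr do rewrite -hom_compA.
Qed.

End TopSharp.

(** An injection into the shift either meets the added block or factors through [inc]; in the latter
    case naturality of [inc] makes it a shifted map after [inc c b]. *)
Lemma span1_lower V b c (B : sub V) (w : V c) : submod B ->
  span1 (lower B w) (fact V (inc c b) w : shift_mod V b c) = shsub b (span1 B w).
Proof.
move=> Bs; have S1 := span1_submod Bs w; have Ls := lower_submod b w Bs.
have S2 := span1_submod Ls (fact V (inc c b) w : shift_mod V b c).
apply: subP => d x; split.
  move: d x; apply: span1_min => [|d x|]; first exact: shsub_submod.
    apply: gspan_min => [|y By|g _]; first exact: S1.1.
      exact: span1_base.
    exact: span1_fact.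
  exact: span1_fact.
rewrite -(gspan_full (b := b) B w (Z := fun _ _ => True)) //; move: x.
apply: gspan_min => [|x Bx|g _]; first exact: S2.1.
  by apply: span1_base; exact: gspan_base.
have [gout|[f ->]] := outside_or g; first by apply: span1_base; exact: gspan_gen.
by rewrite inc_natural fact_comp; apply: (span1_fact Ls).
Qed.

Lemma lower_span V b c (B : sub V) (w : V c) : submod B ->
  exists s : seq (elt (shift_mod V b)), span (shsub b B) s = lower B w /\
    forall v, List.In v s -> (deg (tag v) < deg c)%N.
Proof.
move=> Bs; have [s sP] := enum_shift_homs c b.
pose t := [seq x <- s | `[< onto (tagged x) /\ outside (tagged x) >]].
exists (elts_of w t); split; last first.
  by move=> _ /In_elts_of[x [/In_filter[_ /asboolP[]] hon hout ->]]; exact: onto_outside_deg.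
rewrite span_elts_of // /lower; congr (gspan B w _).
apply: functional_extensionality_dep => d; apply: funext => g; apply: propext; split.
  by move=> [x [/In_filter[_ /asboolP[_ hout]] [f ->]]]; exact: outside_stable.
move=> gout; have [e [h [f [hon hg]]]] := hom_shift_factor g.
exists (existT _ e h); split; last by exists f.
apply/In_filter; split; first exact/sP/(onto_le hon).
(* Shifted maps preserve both blocks, so a point that [g] sends to the added block is already sent
   there by [h]. *)
apply/asboolP; split=> //; move: gout; rewrite -hg => -[i [x [z]]].
rewrite ap_comp /= => hx; exists i, x; move: hx.
by case: (splitV (ap h x)) => y; [rewrite ap_shiftl => /inlrE | exists y].
Qed.

(** Outer induction on the degree bound, for [lower] of the first generator; inner induction on the
    list, for the remaining generators. Between them lies the sharp top quotient. *)
Lemma shift_filt n V (B : sub V) (s : seq (elt V)) : submod B ->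
  (forall w, List.In w s -> (deg (tag w) < n)%N) ->
  exists a, filt (shsub a B) (shsub a (span B s)).
Proof.
elim: n V B s => [|n IH] V B s Bs sn.
  case: s sn => [_|w s /(_ w) H]; last by have := H (or_introl erefl).
  by exists (fun=> 0%N); exact: filt_refl.
elim: s B Bs sn => [|[c w] s IHs] B Bs sn /=; first by exists (fun=> 0%N); exact: filt_refl.
have S1 := span1_submod Bs w; have Ss := span_submod s S1.
have [||a2 F2] := IHs (span1 B w) => //; first by move=> v sv; apply: sn; right.
have [b topb] := top_sharp w Bs.
have [t [tE tdeg]] := lower_span b w Bs.
have [||a1] := IH _ (shsub b B) t; first exact: shsub_submod.
  by move=> v /tdeg vc; apply: leq_trans vc _; have := sn _ (or_introl erefl).
rewrite tE => F1; have Ls := lower_submod b w Bs.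
have := filt_trans F1 (filt_shsub a1 Ls (filt_sharp topb)).
rewrite span1_lower // => /(filt_shsub_add Bs S1) {}F1.
(* The first generator was filtered after the shift by [obj_add a1 b], the others after [a2]; the
   sum serves both. *)
exists (obj_add a2 (obj_add a1 b)); apply: (filt_trans (F := shsub _ (span1 B w))).
  exact: filt_shsub_addl.
by rewrite obj_addC; exact: filt_shsub_addl.
Qed.
End Main.

(** * Quotient modules *)

Section QuotientLmod.
Local Open Scope quotient_scope.
Variables (k : fieldType) (X : lmodType k) (P : X -> Prop) (Pcl : lclosed P).

(** Classical boolean form of [P], as the quotient of additive groups requires. Scalars are then
    made to act through representatives. *)
Definition lclosed_pred : {pred X} := fun x => `[<P x>].

Lemma lclosed_pred_zmod : zmod_closed lclosed_pred.
Proof.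
split; first exact/asboolP/Pcl.1.
by move=> x y /asboolP Px /asboolP Py; apply/asboolP; exact: lclosedB.
Qed.

HB.instance Definition _ := GRing.isZmodClosed.Build X lclosed_pred lclosed_pred_zmod.

Definition quot_lmod := Quotient.quot lclosed_pred.
HB.instance Definition _ := GRing.Zmodule.on quot_lmod.

Definition quot_pi (x : X) : quot_lmod := \pi_(Quotient.quot lclosed_pred) x.

Lemma quot_piE x y : quot_pi x = quot_pi y <-> P (x - y).
Proof.
rewrite -[P _]asboolE; split=> [/eqP|H]; last apply/eqP.
  by rewrite /quot_pi -Quotient.idealrBE.
by rewrite /quot_pi -Quotient.idealrBE.
Qed.

Lemma quot_piD x y : quot_pi (x + y) = quot_pi x + quot_pi y.
Proof. exact: (@Quotient.pi_add X lclosed_pred x y). Qed.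

Definition quot_scale a (q : quot_lmod) : quot_lmod := quot_pi (a *: repr q).

Lemma quot_scaleE a x : quot_scale a (quot_pi x) = quot_pi (a *: x).
Proof.
apply/quot_piE; rewrite -scalerBr; apply: lclosedZ => //; apply/quot_piE.
exact: reprK.
Qed.

Lemma quot_piK (q : quot_lmod) : exists x, q = quot_pi x.
Proof. by exists (repr q); rewrite -[LHS]reprK. Qed.

Lemma quot_scalerA a b q : quot_scale a (quot_scale b q) = quot_scale (a * b) q.
Proof. by have [x ->] := quot_piK q; rewrite !quot_scaleE scalerA. Qed.

Lemma quot_scale1r : left_id 1 quot_scale.
Proof. by move=> q; have [x ->] := quot_piK q; rewrite quot_scaleE scale1r. Qed.

Lemma quot_scalerDr : right_distributive quot_scale +%R.
Proof.
move=> a q r; have [x ->] := quot_piK q; have [y ->] := quot_piK r.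
by rewrite -quot_piD !quot_scaleE scalerDr quot_piD.
Qed.

Lemma quot_scalerDl q : {morph quot_scale^~ q : a b / a + b}.
Proof. by move=> a b; have [x ->] := quot_piK q; rewrite !quot_scaleE scalerDl quot_piD. Qed.

HB.instance Definition _ := GRing.Zmodule_isLmodule.Build k quot_lmod
  quot_scalerA quot_scale1r quot_scalerDr quot_scalerDl.

End QuotientLmod.

Lemma lmod_quotient (k : fieldType) (X : lmodType k) (P : X -> Prop) : lclosed P ->
  exists (Q : lmodType k) (p : X -> Q), [/\ forall a x y, p (a *: x + y) = a *: p x + p y,
    forall q, exists x, p x = q & forall x, p x = 0 <-> P x].
Proof.
move=> Pcl; pose p := quot_pi Pcl; exists (quot_lmod Pcl), p; split=> [a x y|q|x].
- by rewrite /p quot_piD -quot_scaleE.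
- by have [x ->] := quot_piK q; exists x.
- have p0 : p 0 = 0 by apply: (addrI (p 0)); rewrite -quot_piD !addr0.
  by rewrite -p0 quot_piE subr0.
Qed.

(** * Quotients of FI^m-modules *)

Section Resolution.
Variables (k : fieldType) (m : nat).
Implicit Types (V W : FImMod k m) (c d e a b : obj m).

Lemma module_quotient V (K : sub V) : submod K ->
  exists (C : FImMod k m) (p : forall d, V d -> C d),
  [/\ is_mor p, forall d (y : C d), exists x, p d x = y & forall d x, p d x = 0 <-> K d x].
Proof.
move=> Ks; have qP d := cid (lmod_quotient (Ks.1 d)).
pose Q d := projT1 (qP d); pose p d : V d -> Q d := projT1 (cid (projT2 (qP d))).
have pP d : [/\ forall r x y, p d (r *: x + y) = r *: p d x + p d y,
    forall q, exists x, p d x = q & forall x, p d x = 0 <-> K d x] := projT2 (cid (projT2 (qP d))).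
have plin d r x y : p d (r *: x + y) = r *: p d x + p d y by have [] := pP d.
pose s d (q : Q d) : V d := projT1 (cid (let: And3 _ h _ := pP d in h q)).
have sK d (q : Q d) : p d (s d q) = q := projT2 (cid (let: And3 _ h _ := pP d in h q)).
have pker d x : p d x = 0 <-> K d x by have [] := pP d.
have pE d (x y : V d) : p d x = p d y <-> K d (x - y).
  rewrite -pker addrC -scaleN1r plin scaleN1r addrC; split=> [->|/eqP]; first exact: subrr.
  by rewrite subr_eq0 => /eqP.
(* The action uses chosen preimages; [FE] shows that it does not depend on them, [K] being
   stable. *)
pose F c d (f : hom c d) (q : Q c) : Q d := p d (fact V f (s c q)).
have FE c d (f : hom c d) x : F c d f (p c x) = p d (fact V f x).
  apply/pE; rewrite addrC -scaleN1r -fact_lin; apply: Ks.2.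
  by rewrite scaleN1r addrC; apply/pE; exact: sK.
unshelve eexists.
  refine (@Build_FImMod k m Q F _ _ _).
  - by move=> c d f r x y; rewrite -[x]sK -[y]sK -plin !FE -plin -fact_lin.
  - by move=> c x; rewrite -[x]sK FE fact_id.
  - by move=> c d e f g x; rewrite -[x]sK !FE fact_comp.
exists p; split=> //; last by move=> d y; exists (s d y).
by split=> // c d f x; rewrite -[RHS]FE.
Qed.

End Resolution.

(** * Torsion and the resolution *)

Section Filtered.
Variables (k : fieldType) (m : nat).
Hypothesis char0 : [pchar k] =i pred0.
Implicit Types (V W : FImMod k m) (c d e a b : obj m).

Definition full_sub V : sub V := fun d x => True.
Arguments full_sub V [d] x.

Lemma gen_submod V g (c : 'I_g -> obj m) (v : forall j, V (c j)) r : submod (gen v r).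
Proof.
split=> [d|d e f x].
  split; first exact: gen_0.
  by move=> t x y gx gy; apply: gen_add => //; exact: gen_scale.
move=> gx; elim: gx e f => {d x} [j d h jr|d|d x y _ IHx _ IHy|d t x _ IH] e f.
- by rewrite -fact_comp; exact: gen_gen.
- by rewrite fact0; exact: gen_0.
- by rewrite factD; apply: gen_add.
- by rewrite factZ; apply: gen_scale.
Qed.

Lemma gen_min V g (c : 'I_g -> obj m) (v : forall j, V (c j)) r (C : sub V) : submod C ->
  (forall j : 'I_g, (j < r)%N -> C _ (v j)) -> forall d (x : V d), gen v r x -> C d x.
Proof.
move=> Cs vC d x; elim=> {d x} [j d h jr|d|d x y _ Cx _ Cy|d t x _ Cx].
- by apply: Cs.2; exact: vC.
- exact: (Cs.1 d).1.
- exact: (lclosedD (Cs.1 d)).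
- exact: (lclosedZ (Cs.1 d)).
Qed.

Lemma chain_nth V (w0 : elt V) (B : sub V) s r : chain B s -> (r < size s)%N ->
  sharp (span B (take r s)) (tagged (nth w0 s r)).
Proof. by elim: s B r => //= w s IH B [|r] [Bw ws] //= rs; exact: IH. Qed.

Lemma In_nth (T : Type) (x0 : T) (s : seq T) i : (i < size s)%N -> List.In (nth x0 s i) s.
Proof. by elim: s i => //= x s IH [|i] /= si; [left | right; exact: IH]. Qed.

Lemma In_nth_ex (T : Type) (x0 : T) (s : seq T) x : List.In x s ->
  exists2 i, (i < size s)%N & nth x0 s i = x.
Proof.
elim: s => //= y s IH [->|/IH[i si <-]]; first by exists 0%N.
by exists i.+1.
Qed.

(** The stages of the filtration are the spans of the initial segments of [s]. *)
Lemma filt_filtered V : filt (zero_sub V) (full_sub V) -> filtered V.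
Proof.
move=> [s [sc sE]]; pose w0 : elt V := existT (fun c => V c : Type) (fun=> 0%N) 0.
pose c (j : 'I_(size s)) := tag (nth w0 s j).
pose v (j : 'I_(size s)) : V (c j) := tagged (nth w0 s j).
have zs := zero_submod V.
have genE r : (r <= size s)%N -> gen v r = span (zero_sub V) (take r s).
  move=> rs; apply: subP => d x; split; move: d x.
    apply: gen_min => [|j jr]; first exact: span_submod.
    apply: span_gen => //; rewrite -(nth_take w0 jr); apply: In_nth.
    by rewrite size_takel.
  apply: span_min => // [|d x ->|w /(In_nth_ex w0)[i]]; first exact: gen_submod.
    exact: gen_0.
  rewrite size_takel // => ir <-; rewrite nth_take //.
  have := gen_gen v (hom_id _) (j := Ordinal (leq_trans ir rs)) ir.
  by rewrite fact_id.
exists (size s), c, v; split=> [d x|r rs].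
  by rewrite genE // take_size sE.
rewrite !genE ?(ltnW rs) // (take_nth w0 rs) -cats1 span_cat /=.
by apply: sharp_projective => //; [exact: span_submod | exact: chain_nth].
Qed.

(** Push the coefficients of [x] forward along [f]. Sharpness restricts the resulting relation along
    the same [f], which gives the original coefficients back. *)
Lemma filt_torsion V (B L : sub V) : submod B -> filt B L ->
  forall d e (f : hom d e) (x : V d), L d x -> B e (fact V f x) -> B d x.
Proof.
move=> Bs [s [sc <-]]; elim: s B Bs sc => [|[c w] s IH] B Bs //= [Bw ch] d e f x sx Bfx.
have : span1 B w x.
  by apply: (IH _ (span1_submod Bs w) ch d e f x sx); exact: span1_base.
move=> /span1P[y [al [By xE]]]; rewrite xE; apply: lclosedD => //; first exact: Bs.1.
have : B e (\sum_(g' : hom c e) (\sum_(g | hom_comp g f == g') al g) *: fact V g' w).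
  rewrite -(sum_push (fun g => hom_comp g f) al (fun g => fact V g w)).
  under eq_bigr do rewrite fact_comp.
  rewrite -fact_sum; have -> : \sum_(g : hom c d) al g *: fact V g w = x - y.
    by rewrite xE addrAC subrr add0r.
  rewrite addrC -scaleN1r fact_lin scaleN1r addrC.
  by apply: lclosedB => //; [exact: Bs.1 | exact: Bs.2].
move=> /Bw/(_ _ f); congr (B d _); apply: eq_bigr => g _; congr (_ *: _).
rewrite (big_pred1 g) // => g'; exact: (inj_eq (hom_comp_inj (g := f))).
Qed.

(** * Injectivity of the map into a shift *)

Section Swap.
Variables d a : obj m.

(** Exchanges the two copies of [a], by which the inclusion of a shifted object differs from the
    shift of the inclusion. *)
Definition swap_fun i (x : 'I_(obj_add (obj_add d a) a i)) : 'I_(obj_add (obj_add d a) a i) :=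
  match split x with
  | inl y => match split y with inl z => inl_ a (inl_ a z) | inr z => inr_ _ z end
  | inr z => inl_ a (inr_ d z)
  end.

Lemma swap_inj i : injective (@swap_fun i).
Proof.
apply: (can_inj (g := @swap_fun i)) => x; rewrite /swap_fun.
case: (splitV x) => y; last by rewrite (unsplitK (inr _)) (unsplitK (inl _)) (unsplitK (inr _)).
rewrite (unsplitK (inl _)); case: (splitV y) => z.
  by rewrite !(unsplitK (inl _)).
by rewrite !(unsplitK (inr _)).
Qed.

Lemma shift_inc_swap : hom_comp (inc (obj_add d a) a) (mkhom swap_inj) = hom_shift a (inc d a).
Proof.
apply: homP => i x; rewrite ap_comp ap_mkhom ap_inc /swap_fun (unsplitK (inl _)).
case: (splitV x) => y; first by rewrite (unsplitK (inl _)) ap_shiftl ap_inc.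
by rewrite (unsplitK (inr _)) ap_shiftr.
Qed.

End Swap.

(** For [d] above [a], [V d] is a value of the shift by [a], which is torsion free; up to the swap,
    the map is the action of an injection on this shift. *)
Lemma inc_injective V a d : filt (shsub a (zero_sub V)) (shsub a (full_sub V)) ->
  obj_le a d -> injective (fact V (inc d a)).
Proof.
move=> fV ad; have -> : d = obj_add (fun i => d i - a i)%N a.
  by apply: funext => i; rewrite /obj_add subnK.
move: (fun i => _) => d' x y xy; apply/eqP; rewrite -subr_eq0; apply/eqP.
have zs := shsub_submod a (zero_submod V).
apply: (filt_torsion zs fV (d := d') (f := inc d' a)) => //.
rewrite /shsub /zero_sub /= -shift_inc_swap fact_comp.
by rewrite addrC -scaleN1r fact_lin -xy -fact_lin scaleN1r addNr !fact0.
Qed.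

(** The guards on [N] encode the final zero: at the last index the kernel condition is vacuous and
    exactness becomes surjectivity. Beyond [N] the sequence is unconstrained. *)
Definition resolved V := exists (N : nat) (J : nat -> FImMod k m)
         (iota : forall d, V d -> J 0%N d)
         (delta : forall i d, J i d -> J i.+1 d),
    (forall i, (i <= N)%N -> filtered (J i)) /\
    is_mor iota /\
    (forall i, (i < N)%N -> is_mor (delta i)) /\
    ((0 < N)%N -> forall d (x : V d), delta 0%N d (iota d x) = 0) /\
    (forall i, (i.+1 < N)%N -> forall d (x : J i d), delta i.+1 d (delta i d x) = 0) /\
    exists b : obj m, forall d : obj m, obj_le b d ->
      [/\ injective (iota d),
          forall y : J 0%N d, ((0 < N)%N -> delta 0%N d y = 0) ->
            exists x, iota d x = y &
          forall j, (j < N)%N -> forall y : J j.+1 d,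
            ((j.+1 < N)%N -> delta j.+1 d y = 0) -> exists x, delta j d x = y].

Lemma shsub_span_min V a (B : sub V) (s : seq (elt V)) (D : sub (shift_mod V a)) :
  submod B -> submod D -> (forall d (x : shift_mod V a d), shsub a B x -> D d x) ->
  (forall w, List.In w s -> forall d (g : hom (tag w) (obj_add d a)), D d (fact V g (tagged w))) ->
  forall d (x : shift_mod V a d), shsub a (span B s) x -> D d x.
Proof.
elim: s B => [|[c w] s IH] B Bs Ds BD sD d x; first exact: BD.
apply: IH => //; [exact: span1_submod | | by move=> v sv; apply: sD; right].
move=> {}d {}x; rewrite -(gspan_full (b := a) B w (Z := fun _ _ => True)) //.
move: x; apply: gspan_min => [|x|g _]; first exact: Ds.1.
  exact: BD.
by apply: (sD (existT (fun c => V c : Type) c w)); left.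
Qed.

(** Collects generators of all the [lower] submodules into one list, whose image will generate the
    cokernel of the map from [V] to its shift. *)
Lemma lower_gens V a (s : seq (elt V)) n : (forall w, List.In w s -> (deg (tag w) < n.+1)%N) ->
  exists t : seq (elt (shift_mod V a)), (forall v, List.In v t -> (deg (tag v) < n)%N) /\
    forall w, List.In w s -> exists u, (forall v, List.In v u -> List.In v t) /\
      span (shsub a (zero_sub V)) u = lower (zero_sub V) (tagged w).
Proof.
elim: s => [|w s IH] sn; first by exists [::].
have [v sv|t [tn tP]] := IH; first by apply: sn; right.
have [u [uE un]] := lower_span a (tagged w) (zero_submod V).
exists (u ++ t); split=> [v vut|v [<-|sv]].
- case: (List.in_app_or _ _ _ vut) => [vu|]; last exact: tn.
  by apply: leq_trans (un _ vu) _; have := sn w (or_introl erefl).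
- by exists u; split=> // v' v'u; apply: List.in_or_app; left.
- have [u' [u't u'E]] := tP v sv; exists u'; split=> // v' v'u'.
  by apply: List.in_or_app; right; exact: u't.
Qed.

Lemma resolution n V (s : seq (elt V)) : (forall w, List.In w s -> (deg (tag w) < n)%N) ->
  span (zero_sub V) s = full_sub V -> resolved V.
Proof.
elim: n V s => [|n IH] V s sn sE.
  (* No generator is left, so [V] is zero and is its own complex with [N] equal to 0. *)
  have {sn} s0 : s = [::] by case: s sn {sE} => // w s sn; have := sn w (or_introl erefl).
  rewrite s0 /= in sE; have V0 d (x : V d) : x = 0 by rewrite -[_ = _]/(zero_sub V x) sE.
  exists 0%N, (fun=> V), (fun d x => x), (fun i d x => 0); do ?split=> //.
    by move=> i _; apply: filt_filtered; rewrite -sE; exact: filt_refl.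
  by exists (fun=> 0%N) => d _; split=> // y _; exists y.
have zs := zero_submod V.
have [a] := shift_filt char0 zs sn; rewrite sE => aE.
(* The image of [V] in its shift; [C] will be the cokernel. *)
pose K : sub (shift_mod V a) := fun d y => exists x, fact V (inc d a) x = y.
have Ks : submod K.
  split=> [d|d e f _ [x <-]].
    split=> [|r _ _ [x <-] [y <-]]; first by exists 0; rewrite fact0.
    by exists (r *: x + y); rewrite fact_lin.
  by exists (fact V f x); rewrite /= -!fact_comp inc_natural.
have [C [p [pm psurj pker]]] := module_quotient Ks.
have [t [tn tP]] := lower_gens a sn.
pose pt (v : elt (shift_mod V a)) : elt C := existT (fun c => C c : Type) (tag v) (p _ (tagged v)).
have zC := zero_submod C.
have Cs := span_submod (map pt t) zC.
have Ds : submod (fun d (x : shift_mod V a d) => span (zero_sub C) (map pt t) (p d x)).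
  split=> [d|d e f x Dx]; last by rewrite pm.2; exact: Cs.2.
  split; first by rewrite mor0 //; exact: (Cs.1 d).1.
  by move=> r x y Dx Dy; rewrite pm.1; exact: (Cs.1 d).2.
(* An element [g w] lies in some [lower] if [g] meets the added block; otherwise it lies in [K] and
   dies in [C]. *)
have CE : span (zero_sub C) (map pt t) = full_sub C.
  apply: subP => d y; split=> // _; have [x <-] := psurj d y.
  have : shsub a (span (zero_sub V) s) x by rewrite sE.
  move: d x {y}; apply: shsub_span_min => // [d x ->|w sw d g].
    by rewrite mor0 //; exact: (Cs.1 d).1.
  have [u [ut uE]] := tP w sw.
  have [gout|[f ->]] := outside_or g; last first.
    have /pker -> : K d (fact V (hom_comp f (inc d a)) (tagged w)).
      by exists (fact V f (tagged w)); rewrite fact_comp.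
    exact: (Cs.1 d).1.
  have : span (shsub a (zero_sub V)) u (fact V g (tagged w) : shift_mod V a d).
    by rewrite uE; apply: gspan_gen.
  move: (fact V g _); apply: (span_min (shsub_submod a zs) Ds) => [e x ->|v uv].
    by rewrite mor0 //; exact: (Cs.1 e).1.
  by apply: (span_gen zC (w := pt v)); apply: List.in_map; exact: ut.
have [v|N [J [iota [delta [Jf [im [dm [di [dd [b bP]]]]]]]]]] := IH C (map pt t) _ CE.
  by move=> /List.in_map_iff[v' [<- /tn]].
(* Splice: the new first differential is the projection to [C] followed by [iota]. *)
pose J' i := if i is i'.+1 then J i' else shift_mod V a.
pose delta' i : forall d, J' i d -> J' i.+1 d :=
  match i return forall d, J' i d -> J' i.+1 d with
  | 0 => fun d x => iota d (p d x)
  | i'.+1 => delta i'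
  end.
have im0 d : iota d 0 = 0 by exact: mor0.
exists N.+1, J', (fun d x => fact V (inc d a) x), delta'.
split; first by case=> [_|i iN]; [exact: filt_filtered | exact: Jf].
split; first by split=> [d r x y|c d f x]; rewrite ?fact_lin //= -!fact_comp inc_natural.
split.
  case=> [_|i iN]; last exact: dm.
  by split=> [d r x y|c d f x] /=; rewrite ?pm.1 ?im.1 // pm.2 im.2.
split; first by move=> _ d x /=; have /pker -> : K d (fact V (inc d a) x) by exists x.
split; first by case=> [|i] iN d x /=; [exact: di | exact: dd].
(* The bound [a] serves for injectivity of [inc], the bound [b] for exactness of the complex of
   [C]. *)
exists (fun i => maxn (a i) (b i)) => d abd.
have ad : obj_le a d by move=> i; apply: leq_trans (abd i); exact: leq_maxl.
have bd : obj_le b d by move=> i; apply: leq_trans (abd i); exact: leq_maxr.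
have [iinj i0 ij] := bP d bd.
split; first exact: inc_injective.
  by move=> y /(_ isT) /= iy; apply/pker/iinj; rewrite iy im0.
case=> [_|j jN] y yN /=; last exact: ij.
by have [z <-] := i0 y yN; have [x <-] := psurj d z; exists x.
Qed.

End Filtered.
Arguments full_sub {k m} V [d] x.

Theorem theorem2p5 (k : fieldType) (m : nat) (V : FImMod k m) :
  [pchar k] =i pred0 ->
  finitely_generated V ->
  (exists a : obj m, filtered (shift_mod V a)) /\
  exists (N : nat) (J : nat -> FImMod k m)
         (iota : forall d, V d -> J 0%N d)
         (delta : forall i d, J i d -> J i.+1 d),
    (forall i, (i <= N)%N -> filtered (J i)) /\
    (* 0 -> V -> J^0 -> ... -> J^N -> 0 is a complex of FI^m-modules *)
    is_mor iota /\
    (forall i, (i < N)%N -> is_mor (delta i)) /\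
    ((0 < N)%N -> forall d (x : V d), delta 0%N d (iota d x) = 0) /\
    (forall i, (i.+1 < N)%N -> forall d (x : J i d), delta i.+1 d (delta i d x) = 0) /\
    (* which is exact in all sufficiently large degrees d *)
    exists b : obj m, forall d : obj m, obj_le b d ->
      [/\ injective (iota d),
          forall y : J 0%N d, ((0 < N)%N -> delta 0%N d y = 0) ->
            exists x, iota d x = y &
          forall j, (j < N)%N -> forall y : J j.+1 d,
            ((j.+1 < N)%N -> delta j.+1 d y = 0) -> exists x, delta j d x = y].
Proof.
move=> char0 [g [c [v vgen]]].
pose s : seq (elt V) := [seq existT (fun c => V c : Type) (c j) (v j) | j <- enum 'I_g].
have zs := zero_submod V.
have sE : span (zero_sub V) s = full_sub V.
  apply: subP => d x; split=> // _; move: (vgen d x).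
  apply: gen_min => [|j _]; first exact: span_submod.
  have js : List.In (existT (fun c => V c : Type) (c j) (v j)) s.
    apply: (List.in_map (fun j => existT (fun c => V c : Type) (c j) (v j))).
    by apply: In_mem; rewrite mem_enum.
  exact: (span_gen zs js).
(* The finitely many generators have bounded degree, and this bound drives both inductions. *)
have [n sn] : exists n, forall w, List.In w s -> (deg (tag w) < n)%N.
  elim: s {sE} => [|w s [n sn]]; first by exists 0%N.
  exists (maxn (deg (tag w)).+1 n) => v' [<-|/sn]; first exact: leq_maxl.
  by move=> v'n; apply: leq_trans v'n _; exact: leq_maxr.
split; last exact: resolution sn sE.
have [a] := shift_filt char0 zs sn; rewrite sE => aE.
by exists a; exact: filt_filtered.
Qed.
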